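(* Let $n\ge 3$ and let $(M^n,g,f)$ be an $n$-dimensional CPE metric whose potential function $f$ is non-constant. Then $(M^n,g)$ is Einstein if and only if $f\in\ker\Lambda_g^*$, i.e. if and only if $(M^n,g,f)$ is a $\sigma_2$-singular space.
   Context: Notation. For a Riemannian metric $g$, $Ric_g$ and $R_g$ denote the Ricci and scalar curvatures, $\mathring{Ric}_g=Ric_g-\frac{R_g}{n}g$ the traceless Ricci tensor, $\nabla^2$ the Hessian (second covariant derivative), $\Delta_g=\mathrm{tr}_g\nabla^2$ the Laplacian, and $S_2(M)$ the space of smooth symmetric 2-tensors on $M$. $(M^n,g)$ is Einstein if $\mathring{Ric}_g=0$ identically (equivalently, $Ric_g=\lambda g$ for some function $\lambda$). CPE metric. A CPE metric is a triple $(M^n,g,f)$, where $(M^n,g)$ is a closed (compact without boundary) oriented Riemannian manifold of dimension $n\ge3$ with constant scalar curvature and volume $1$, and $f$ is a smooth function on $M$ (the potential) satisfying the critical point equation $$\nabla^2 f-(\Delta_g f)g-f\,Ric_g=\mathring{Ric}_g .$$ $\sigma_2$-curvature. $\sigma_2(g)$ is the second elementary symmetric function of the eigenvalues of $A_g=Ric_g-\frac{R_g}{2(n-1)}g$, i.e. $\sigma_2(g)=-\frac12|Ric_g|^2+\frac{n}{8(n-1)}R_g^2$. $\Lambda_g:S_2(M)\to C^\infty(M)$ is the linearization at $g$ of the map $g\mapsto\sigma_2(g)$, and $\Lambda_g^*:C^\infty(M)\to S_2(M)$ is its $L^2$-formal adjoint. Explicitly, $$\Lambda_g^*(f)=\tfrac12\Delta_g(f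 Ric_g)+\tfrac12\delta^2(f Ric_g)g+\delta^*\delta(f Ric_g)+f\mathring R(Ric_g)-\tfrac{n}{4(n-1)}\left(\Delta_g(fR_g)g-\nabla^2(fR_g)+fR_gRic_g\right),$$ where $\delta=-\mathrm{div}_g$, $\delta^*$ is the $L^2$-formal adjoint of $\delta$ (the symmetrized covariant derivative of a 1-form), $\delta^2=\delta\circ\delta$, $\Delta_g$ on tensors is the rough Laplacian, and $\mathring R(h)_{ij}=g^{kl}g^{st}R_{kijs}h_{lt}$, with the curvature sign convention for which $\mathring R(g)=Ric_g$. $\sigma_2$-singular space. $(M^n,g,f)$ is a $\sigma_2$-singular space if $(M,g)$ is a complete Riemannian manifold and $f$ is a nontrivial (not identically zero) function in $\ker\Lambda_g^*$. *)

(* Defs.v *)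
From HB Require Import structures.
From mathcomp Require Import all_boot all_order all_algebra.
From mathcomp Require Import all_classical all_reals all_analysis.

Set Implicit Arguments.
Unset Strict Implicit.
Unset Printing Implicit Defensive.

Import Order.TTheory GRing.Theory Num.Theory.
Import numFieldNormedType.Exports.

Local Open Scope classical_set_scope.
Local Open Scope ring_scope.

Definition partial (R : realType) (n : nat) (i : 'I_n) (u : 'rV[R]_n -> R) :
  'rV[R]_n -> R := fun x => 'D_(delta_mx 0 i) u x.

(* For U open this is C^oo: every iterated partial derivative exists and is
   (Frechet) differentiable, hence continuous, at every point of U. *)
Definition smooth_on (R : realType) (n : nat) (U : set 'rV[R]_n)
    (u : 'rV[R]_n -> R) : Prop :=
  forall (s : seq 'I_n) (x : 'rV[R]_n), U x ->
    differentiable (foldr (@partial R n) u s) x.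

(* [coord] and [param] are total functions; only their values on [dom] and [cod]
   are meaningful.  As [dom] and [cod] are open, pointwise continuity there is
   continuity of the restrictions, so a chart is a homeomorphism from an open
   set of M onto an open set of R^n (in particular there is no boundary). *)
Record chart (R : realType) (n : nat) (M : ptopologicalType) := Chart {
  dom : set M;
  cod : set 'rV[R]_n;
  coord : M -> 'rV[R]_n;
  param : 'rV[R]_n -> M;
  dom_open : open dom;
  cod_open : open cod;
  coord_cod : forall p, dom p -> cod (coord p);
  param_dom : forall x, cod x -> dom (param x);
  coordK : forall p, dom p -> param (coord p) = p;
  paramK : forall x, cod x -> coord (param x) = x;
  coord_continuous : forall p, dom p -> {for p, continuous coord};
  param_continuous : forall x, cod x -> {for x, continuous param}
}.

Definition transition (R : realType) (n : nat) (M : ptopologicalType)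
    (c c' : chart R n M) : 'rV[R]_n -> 'rV[R]_n := coord c' \o param c.

Definition overlap (R : realType) (n : nat) (M : ptopologicalType)
    (c c' : chart R n M) : set 'rV[R]_n := cod c `&` param c @^-1` dom c'.

(* The atlas need not be maximal, and M need not be connected.  The point of M
   provided by ptopologicalType only says that M is nonempty, as required by
   the library's generated sigma-algebras. *)
Record smooth_structure (R : realType) (n : nat) (M : ptopologicalType) :=
  SmoothStructure {
  atlas : set (chart R n M);
  chart_at : M -> chart R n M;
  chart_at_atlas : forall p, atlas (chart_at p);
  chart_at_dom : forall p, dom (chart_at p) p;
  transition_smooth : forall c c', atlas c -> atlas c' ->
    forall j, smooth_on (overlap c c') (fun x => transition c c' x 0 j);
  manifold_hausdorff : hausdorff_space M;
  manifold_second_countable : @second_countable M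
}.

Definition closed_manifold (R : realType) (n : nat) (M : ptopologicalType)
    (S : smooth_structure R n M) : Prop := compact [set: M].

(* An orientation is given by an atlas whose transition maps all have positive
   Jacobian determinant. *)
Definition oriented (R : realType) (n : nat) (M : ptopologicalType)
    (S : smooth_structure R n M) : Prop :=
  forall c c', atlas S c -> atlas S c' ->
    forall x, overlap c c' x -> 0 < \det (jacobian (transition c c') x).

Definition smooth_function (R : realType) (n : nat) (M : ptopologicalType)
    (S : smooth_structure R n M) (f : M -> R) : Prop :=
  forall c, atlas S c -> smooth_on (cod c) (f \o param c).

(* [gmat g c x] is the Gram matrix g(d_i, d_j) in the chart c at the point of
   coordinates x.  The library's Jacobian acts on row vectors from the right:
   (jacobian T x) i j = d_i T_j. *)
Record riemannian_metric (R : realType) (n : nat) (M : ptopologicalType)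
    (S : smooth_structure R n M) := RiemannianMetric {
  gmat :> chart R n M -> 'rV[R]_n -> 'M[R]_n;
  gmat_smooth : forall c, atlas S c ->
    forall i j, smooth_on (cod c) (fun x => gmat c x i j);
  gmat_sym : forall c, atlas S c -> forall x, cod c x ->
    (gmat c x)^T = gmat c x;
  gmat_posdef : forall c, atlas S c -> forall x, cod c x ->
    forall v : 'rV[R]_n, v != 0 -> 0 < (v *m gmat c x *m v^T) 0 0;
  gmat_change : forall c c', atlas S c -> atlas S c' ->
    forall x, overlap c c' x ->
      gmat c x = jacobian (transition c c') x *m gmat c' (transition c c' x)
                 *m (jacobian (transition c c') x)^T
}.

(* G is the matrix of metric coefficients in a coordinate domain.  Covariant
   tensor fields of rank 1, 2, 3 are given by their component functions [w i],
   [h i j], [T i j k].  In [cov1], [cov2], [cov3] the first index is the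
   direction of differentiation. *)

Section LocalGeometry.
Context (R : realType) (n : nat) (G : 'rV[R]_n -> 'M[R]_n).
Implicit Types (u : 'rV[R]_n -> R) (w : 'I_n -> 'rV[R]_n -> R)
  (h : 'I_n -> 'I_n -> 'rV[R]_n -> R)
  (T : 'I_n -> 'I_n -> 'I_n -> 'rV[R]_n -> R) (x : 'rV[R]_n).

Definition lower_g (i j : 'I_n) x : R := G x i j.

Definition upper_g (i j : 'I_n) x : R := invmx (G x) i j.

(* Gamma^k_ij *)
Definition christoffel (k i j : 'I_n) x : R :=
  2^-1 * \sum_l upper_g k l x *
    (partial i (lower_g j l) x + partial j (lower_g i l) x
     - partial l (lower_g i j) x).

Definition cov1 w (k i : 'I_n) x : R :=
  partial k (w i) x - \sum_m christoffel m k i x * w m x.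

Definition cov2 h (k i j : 'I_n) x : R :=
  partial k (h i j) x
  - \sum_m christoffel m k i x * h m j x
  - \sum_m christoffel m k j x * h i m x.

Definition cov3 T (k a i j : 'I_n) x : R :=
  partial k (T a i j) x
  - \sum_m christoffel m k a x * T m i j x
  - \sum_m christoffel m k i x * T a m j x
  - \sum_m christoffel m k j x * T a i m x.

Definition trace_g h x : R := \sum_i \sum_j upper_g i j x * h i j x.

Definition hessian u : 'I_n -> 'I_n -> 'rV[R]_n -> R :=
  cov1 (fun i => partial i u).

Definition laplacian u : 'rV[R]_n -> R := trace_g (hessian u).

Definition rough_laplacian h (i j : 'I_n) x : R :=
  \sum_k \sum_l upper_g k l x * cov3 (cov2 h) k l i j x.

(* delta = - div *)
Definition delta1 w x : R := - trace_g (cov1 w) x.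

Definition delta2 h (j : 'I_n) x : R :=
  - \sum_i \sum_k upper_g i k x * cov2 h i k j x.

Definition delta_star w (i j : 'I_n) x : R :=
  2^-1 * (cov1 w i j x + cov1 w j i x).

(* R(d_i, d_j) d_k = sum_m (riemann_up i j k m) d_m, where
   R(X, Y) Z = nabla_X nabla_Y Z - nabla_Y nabla_X Z - nabla_[X,Y] Z. *)
Definition riemann_up (i j k m : 'I_n) x : R :=
  partial i (christoffel m j k) x - partial j (christoffel m i k) x
  + \sum_p (christoffel p j k x * christoffel m i p x
            - christoffel p i k x * christoffel m j p x).

(* R_ijkl = g(R(d_i, d_j) d_k, d_l); with this sign the contraction of the
   first and last indices is the Ricci tensor (positive on round spheres), so
   that curv_action lower_g = ricci. *)
Definition riemann (i j k l : 'I_n) x : R :=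
  \sum_m lower_g l m x * riemann_up i j k m x.

Definition ricci (i j : 'I_n) x : R :=
  \sum_k \sum_l upper_g k l x * riemann k i j l x.

Definition scalar_curvature : 'rV[R]_n -> R := trace_g ricci.

Definition traceless_ricci (i j : 'I_n) x : R :=
  ricci i j x - scalar_curvature x / n%:R * lower_g i j x.

(* g^{kl} g^{st} R_{kijs} h_{lt} *)
Definition curv_action h (i j : 'I_n) x : R :=
  \sum_k \sum_l \sum_s \sum_t
    upper_g k l x * upper_g s t x * riemann k i j s x * h l t x.

(* The L^2-formal adjoint of the linearization of the sigma_2-curvature,
   applied to u:
     1/2 Delta(u Ric) + 1/2 delta^2(u Ric) g + delta^* delta (u Ric)
     + u curv_action(Ric)
     - n/(4(n-1)) (Delta(u R) g - nabla^2(u R) + u R Ric). *)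
Definition Lambda_star_coord u (i j : 'I_n) x : R :=
  let uRic a b y := u y * ricci a b y in
  let uR y := u y * scalar_curvature y in
  2^-1 * rough_laplacian uRic i j x
  + 2^-1 * delta1 (delta2 uRic) x * lower_g i j x
  + delta_star (delta2 uRic) i j x
  + u x * curv_action ricci i j x
  - n%:R / (4 * (n%:R - 1)) *
    (laplacian uR x * lower_g i j x - hessian uR i j x
     + u x * scalar_curvature x * ricci i j x).

End LocalGeometry.

(* Iterated Lebesgue integral over R^n; by Tonelli, for nonnegative Borel F it
   is the integral against n-dimensional Lebesgue measure. *)
Fixpoint lebesgue_iint (R : realType) (n : nat) :
    ('rV[R]_n -> \bar R) -> \bar R :=
  match n return ('rV[R]_n -> \bar R) -> \bar R with
  | 0 => fun F => F 0
  | m.+1 => fun F =>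
      (\int[@lebesgue_measure R]_t
         lebesgue_iint (fun v : 'rV[R]_m => F (row_mx (const_mx t : 'rV_1) v)))%E
  end.

Section Global.
Context (R : realType) (n : nat) (M : ptopologicalType)
  (S : smooth_structure R n M).
Implicit Types (g : riemannian_metric S) (f : M -> R).

(* The Borel measure given by sqrt (det g) dx^1...dx^n in every chart. *)
Definition is_riemannian_volume g
    (mu : {measure set (g_sigma_algebraType (@open M)) -> \bar R}) : Prop :=
  forall c, atlas S c ->
  forall A : set (g_sigma_algebraType (@open M)), measurable A ->
    A `<=` dom c ->
    mu A = lebesgue_iint (fun x =>
      (\1_(cod c `&` param c @^-1` A) x * Num.sqrt (\det (g c x)))%:E).

Definition has_volume g (v : \bar R) : Prop :=
  exists mu : {measure set (g_sigma_algebraType (@open M)) -> \bar R},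
    is_riemannian_volume g mu /\ mu setT = v.

(* gamma is C^1 in a neighbourhood of each point of [a, b]; every C^1 map on
   [a, b] has such an extension. *)
Definition C1_arc (a b : R) (gamma : R -> M) : Prop :=
  a <= b /\
  forall t, a <= t <= b ->
    {for t, continuous gamma} /\
    forall c, atlas S c -> dom c (gamma t) ->
      (\forall s \near t, derivable (coord c \o gamma) s 1) /\
      {for t, continuous (derive1 (coord c \o gamma))}.

Definition speed g (gamma : R -> M) (t : R) : R :=
  let c := chart_at S (gamma t) in
  let v := (derive1 (coord c \o gamma)) t in
  Num.sqrt ((v *m g c (coord c (gamma t)) *m v^T) 0 0).

(* [path_length g p q l]: some piecewise C^1 path from p to q has length l. *)
Inductive path_length g : M -> M -> \bar R -> Prop :=
| path_arc (a b : R) (gamma : R -> M) : C1_arc a b gamma ->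
    path_length g (gamma a) (gamma b)
      (\int[@lebesgue_measure R]_(t in `[a, b]) (speed g gamma t)%:E)%E
| path_cat (p q r : M) (l1 l2 : \bar R) :
    path_length g p q l1 -> path_length g q r l2 ->
    path_length g p r (l1 + l2)%E.

(* +oo for points in different components. *)
Definition riemannian_dist g (p q : M) : \bar R :=
  ereal_inf [set l | path_length g p q l].

(* Completeness as a metric space for the Riemannian distance (which is
   equivalent to geodesic completeness by Hopf-Rinow). *)
Definition complete_metric g : Prop :=
  forall u : nat -> M,
    (forall e : R, 0 < e -> exists N, forall m k, (N <= m)%N -> (N <= k)%N ->
       (riemannian_dist g (u m) (u k) < e%:E)%E) ->
    exists p, forall e : R, 0 < e -> exists N, forall m, (N <= m)%N ->
       (riemannian_dist g (u m) p < e%:E)%E.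

Definition einstein g : Prop :=
  forall c x, atlas S c -> cod c x ->
    forall i j, traceless_ricci (g c) i j x = 0.

Definition constant_scalar_curvature g : Prop :=
  exists k : R, forall c x, atlas S c -> cod c x ->
    scalar_curvature (g c) x = k.

Definition critical_point_equation g f : Prop :=
  forall c x, atlas S c -> cod c x ->
    let u := f \o param c in
    forall i j,
      hessian (g c) u i j x - laplacian (g c) u x * lower_g (g c) i j x
        - u x * ricci (g c) i j x
      = traceless_ricci (g c) i j x.

Record CPE_metric g f : Prop := CPEMetric {
  CPE_dim : (3 <= n)%N;
  CPE_closed : closed_manifold S;
  CPE_oriented : oriented S;
  CPE_scalar : constant_scalar_curvature g;
  CPE_volume : has_volume g 1%E;
  CPE_smooth : smooth_function S f;
  CPE_equation : critical_point_equation g f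
}.

Definition in_ker_Lambda_star g f : Prop :=
  smooth_function S f /\
  forall c x, atlas S c -> cod c x ->
    forall i j, Lambda_star_coord (g c) (f \o param c) i j x = 0.

Record sigma2_singular g f : Prop := Sigma2Singular {
  sigma2_complete : complete_metric g;
  sigma2_nontrivial : exists p, f p != 0;
  sigma2_ker : in_ker_Lambda_star g f
}.

End Global.

(* Main.v *)
From HB Require Import structures.
Require Import Defs.
From mathcomp Require Import all_boot all_order all_algebra.
From mathcomp Require Import all_classical all_reals all_analysis.
From mathcomp Require Import ring lra.

Set Implicit Arguments.
Unset Strict Implicit.
Unset Printing Implicit Defensive.

Import Order.TTheory GRing.Theory Num.Theory.
Import numFieldNormedType.Exports.

Local Open Scope classical_set_scope.
Local Open Scope ring_scope.

(** Except for completeness, everything happens pointwise in a chart.  Write k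
    for the constant scalar curvature and Ric0 for the traceless Ricci tensor.

    If Ric0 = 0, then Ric = (k/n) g, and since g is parallel all the
    derivatives in Lambda^*(f) fall on f: Lambda^*(f) becomes a constant
    multiple of (Delta f) g - Hess f + f Ric, which the critical point equation
    makes zero ([einstein_in_kernel]).

    For the converse, take the trace of Lambda^*(f) = 0.  The contracted second
    Bianchi identity [contracted_bianchi] says that Ric is divergence free, so
    the double divergence of f Ric is <Hess f, Ric> ([double_divergence]).
    Substituting the critical point equation for Hess f and its trace for
    Delta f leaves (n f + n - 2) |Ric0|^2 = 0 ([kernel_identity]).  Suppose that
    Ric0 does not vanish at some point.  Then it does not vanish nearby, so
    there f is the constant -(n-2)/n and Hess f = 0; the traced equation
    f k = 0 gives k = 0, and the equation itself becomes (1 + f) Ric = 0 with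
    1 + f = 2/n.  Hence Ric = 0, a contradiction ([kernel_einstein]).

    The second equivalence adds that a compact manifold is complete: a Cauchy
    sequence has a cluster point, and points close to it in the topology are
    close in the Riemannian distance because coordinate segments are short
    ([closed_manifold_complete]).

    The tensor calculus is done with matrices.  The Christoffel symbols with
    one lower index k frozen form a matrix A_k such that the covariant
    derivative is d_k w - A_k w on covectors and d_k h - A_k h - h A_k^T on
    2-tensors.  Metric compatibility reads d_k G = A_k G + G A_k^T, and the
    symmetries of the curvature become identities between noncommutative
    polynomials in the A_k and their derivatives. *)

(** * Smooth functions on an open set *)

Lemma near_eq_differentiable (R : numFieldType) (V W : normedModType R)
    (u v : V -> W) (x : V) :
  (\near x, u x = v x) -> differentiable u x -> differentiable v x.
Proof.
move=> uv /diff_locallyP [duc du].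
have uvx : u x = v x by exact: nbhs_singleton uv.
have dv : v \o shift x = cst (v x) + 'd u x +o_ (0 : V) id.
  apply/eqaddoP => e e0; rewrite -uvx.
  have uv0 : \forall h \near (0 : V), u (h + x) = v (h + x).
    by move: uv; rewrite (near_shift 0 x) /= subr0.
  move/eqaddoP : du => /(_ e e0) du.
  near=> h.
  have uvh : u (h + x) = v (h + x) by near: h.
  rewrite fctE /= -uvh; near: h.
  exact: du.
by apply/diff_locallyP; rewrite (diff_unique duc dv).
Unshelve. all: by end_near. Qed.

Section SmoothFunctions.
Context (R : realType) (n : nat) (U : set 'rV[R]_n).
Context (openU : open U).
Implicit Types (u v : 'rV[R]_n -> R) (x : 'rV[R]_n).

Definition eq_on u v := forall x, U x -> u x = v x.

Lemma eq_on_near u v x : eq_on u v -> U x -> \near x, u x = v x.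
Proof.
move=> uv Ux; have : \forall y \near x, U y by exact: open_nbhs_nbhs.
by apply: filterS => y /uv.
Qed.

Lemma partial_local i u v : eq_on u v -> eq_on (partial i u) (partial i v).
Proof. by move=> uv x Ux; apply: near_eq_derive; exact: eq_on_near. Qed.

Lemma iter_partial_local s u v :
  eq_on u v -> eq_on (foldr (@partial R n) u s) (foldr (@partial R n) v s).
Proof. by move=> uv; elim: s => //= i s; exact: partial_local. Qed.

(** Smoothness up to order k: products and inverses are treated by induction on
    the order. *)
Definition csmooth k u := forall (s : seq 'I_n), (size s <= k)%N ->
  forall x, U x -> differentiable (foldr (@partial R n) u s) x.

Lemma csmooth_local k u v : eq_on u v -> csmooth k u -> csmooth k v.
Proof.
move=> uv su s sk x Ux; apply: near_eq_differentiable (su s sk x Ux).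
by apply: eq_on_near => //; exact: iter_partial_local.
Qed.

Lemma csmooth_leq k l u : (k <= l)%N -> csmooth l u -> csmooth k u.
Proof. by move=> kl su s sk; apply: su; exact: leq_trans kl. Qed.

Lemma csmooth_diff k u x : U x -> csmooth k u -> differentiable u x.
Proof. by move=> Ux su; exact: (su [::]). Qed.

(** The innermost derivative is split off, so that the Leibniz rule applies
    before the remaining k differentiations. *)
Lemma csmoothS k u : csmooth k.+1 u <->
  (forall x, U x -> differentiable u x) /\ (forall i, csmooth k (partial i u)).
Proof.
split=> [su|[du su] s].
  split=> [x Ux|i s sk x Ux]; first exact: csmooth_diff su.
  by have := su (rcons s i); rewrite size_rcons foldr_rcons; apply.
case: (lastP s) => [|s' i]; first by move=> _ x Ux; exact: du.
by rewrite size_rcons foldr_rcons => sk; exact: su.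
Qed.

Lemma smooth_csmooth u : smooth_on U u <-> forall k, csmooth k u.
Proof.
by split=> [su k s _ x Ux|su s x Ux]; [exact: su|exact: (su (size s) s)].
Qed.

Lemma partial_cst i (a : R) x : partial i (fun=> a) x = 0.
Proof. exact: derive_cst. Qed.

Lemma partialD i u v x : differentiable u x -> differentiable v x ->
  partial i (fun y => u y + v y) x = partial i u x + partial i v x.
Proof. by move=> du dv; apply: deriveD; exact: diff_derivable. Qed.

Lemma partialN i u x : differentiable u x ->
  partial i (fun y => - u y) x = - partial i u x.
Proof. by move=> du; apply: deriveN; exact: diff_derivable. Qed.

Lemma partialM i u v x : differentiable u x -> differentiable v x ->
  partial i (fun y => u y * v y) x = partial i u x * v x + u x * partial i v x.
Proof.
move=> du dv; rewrite /partial [LHS]deriveM; [|exact: diff_derivable..].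
by rewrite addrC /GRing.scale /= [v x * _]mulrC.
Qed.

Lemma partialV i u x : differentiable u x -> u x != 0 ->
  partial i (fun y => (u y)^-1) x = - (partial i u x * ((u x)^-1 * (u x)^-1)).
Proof.
move=> du ux; rewrite /partial [LHS]deriveV //; last exact: diff_derivable.
by rewrite /GRing.scale /= -exprVn expr2 mulNr mulrC.
Qed.

Lemma csmooth_cst k (a : R) : csmooth k (fun=> a).
Proof.
elim: k a => [|k IH] a.
  by move=> [] // _ x _; exact: differentiable_cst.
apply/csmoothS; split=> [x _|i]; first exact: differentiable_cst.
by apply: csmooth_local (IH 0) => x _; rewrite partial_cst.
Qed.

Lemma csmoothD k u v :
  csmooth k u -> csmooth k v -> csmooth k (fun y => u y + v y).
Proof.
elim: k u v => [|k IH] u v su sv.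
  move=> [] // _ x Ux.
  exact: (differentiableD (csmooth_diff Ux su) (csmooth_diff Ux sv)).
apply/csmoothS; split=> [x Ux|i].
  by exact: (differentiableD (csmooth_diff Ux su) (csmooth_diff Ux sv)).
have /csmoothS[du dsu] := su; have /csmoothS[dv dsv] := sv.
apply: csmooth_local (IH _ _ (dsu i) (dsv i)) => x Ux.
by rewrite partialD //; [exact: du|exact: dv].
Qed.

Lemma csmoothM k u v :
  csmooth k u -> csmooth k v -> csmooth k (fun y => u y * v y).
Proof.
elim: k u v => [|k IH] u v su sv.
  move=> [] // _ x Ux.
  exact: (differentiableM (csmooth_diff Ux su) (csmooth_diff Ux sv)).
apply/csmoothS; split=> [x Ux|i].
  by exact: (differentiableM (csmooth_diff Ux su) (csmooth_diff Ux sv)).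
have /csmoothS[du dsu] := su; have /csmoothS[dv dsv] := sv.
have su' := csmooth_leq (leqnSn k) su; have sv' := csmooth_leq (leqnSn k) sv.
apply: csmooth_local (csmoothD (IH _ _ (dsu i) sv') (IH _ _ su' (dsv i))).
by move=> x Ux; rewrite partialM //; [exact: du|exact: dv].
Qed.

Lemma csmoothN k u : csmooth k u -> csmooth k (fun y => - u y).
Proof.
move=> su; apply: csmooth_local (csmoothM (csmooth_cst (-1)) su) => x _.
by rewrite mulN1r.
Qed.

Lemma csmoothV k u : (forall x, U x -> u x != 0) ->
  csmooth k u -> csmooth k (fun y => (u y)^-1).
Proof.
move=> u0; elim: k => [|k IH] su.
  move=> [] // _ x Ux; apply: differentiableV; last exact: u0.
  exact: csmooth_diff su.
apply/csmoothS; split=> [x Ux|i].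
  by apply: differentiableV; [exact: csmooth_diff su|exact: u0].
have /csmoothS[du dsu] := su.
have sV := IH (csmooth_leq (leqnSn k) su).
apply: csmooth_local (csmoothN (csmoothM (dsu i) (csmoothM sV sV))) => x Ux.
by rewrite partialV //; [exact: du|exact: u0].
Qed.

Lemma smooth_local u v : eq_on u v -> smooth_on U u -> smooth_on U v.
Proof.
move=> uv /smooth_csmooth su; apply/smooth_csmooth => k; exact: csmooth_local uv _.
Qed.

Lemma smooth_diff u x : U x -> smooth_on U u -> differentiable u x.
Proof. by move=> Ux su; exact: (su [::]). Qed.

Lemma smooth_partial i u : smooth_on U u -> smooth_on U (partial i u).
Proof. by move=> su s x Ux; have := su (rcons s i) x Ux; rewrite foldr_rcons. Qed.

Lemma smooth_cst (a : R) : smooth_on U (fun=> a).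
Proof. by apply/smooth_csmooth => k; exact: csmooth_cst. Qed.

Lemma smoothD u v :
  smooth_on U u -> smooth_on U v -> smooth_on U (fun y => u y + v y).
Proof.
move=> /smooth_csmooth su /smooth_csmooth sv.
by apply/smooth_csmooth => k; exact: csmoothD.
Qed.

Lemma smoothN u : smooth_on U u -> smooth_on U (fun y => - u y).
Proof.
by move=> /smooth_csmooth su; apply/smooth_csmooth => k; exact: csmoothN.
Qed.

Lemma smoothM u v :
  smooth_on U u -> smooth_on U v -> smooth_on U (fun y => u y * v y).
Proof.
move=> /smooth_csmooth su /smooth_csmooth sv.
by apply/smooth_csmooth => k; exact: csmoothM.
Qed.

Lemma smoothV u : (forall x, U x -> u x != 0) ->
  smooth_on U u -> smooth_on U (fun y => (u y)^-1).
Proof.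
by move=> u0 /smooth_csmooth su; apply/smooth_csmooth => k; exact: csmoothV.
Qed.

Lemma smooth_sum (I : Type) (r : seq I) (P : pred I) (F : I -> 'rV[R]_n -> R) :
  (forall i, smooth_on U (F i)) ->
  smooth_on U (fun y => \sum_(i <- r | P i) F i y).
Proof.
move=> sF; elim: r => [|i r IH].
  by apply: smooth_local (smooth_cst 0) => x _; rewrite big_nil.
case Pi: (P i); last by apply: smooth_local IH => x _; rewrite big_cons Pi.
by apply: smooth_local (smoothD (sF i) IH) => x _; rewrite big_cons Pi.
Qed.

Lemma smooth_prod (I : Type) (r : seq I) (P : pred I) (F : I -> 'rV[R]_n -> R) :
  (forall i, smooth_on U (F i)) ->
  smooth_on U (fun y => \prod_(i <- r | P i) F i y).
Proof.
move=> sF; elim: r => [|i r IH].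
  by apply: smooth_local (smooth_cst 1) => x _; rewrite big_nil.
case Pi: (P i); last by apply: smooth_local IH => x _; rewrite big_cons Pi.
by apply: smooth_local (smoothM (sF i) IH) => x _; rewrite big_cons Pi.
Qed.

Lemma partial_sum (I : Type) (r : seq I) (P : pred I) (F : I -> 'rV[R]_n -> R)
    k x : (forall i, smooth_on U (F i)) -> U x ->
  partial k (fun y => \sum_(i <- r | P i) F i y) x =
  \sum_(i <- r | P i) partial k (F i) x.
Proof.
move=> sF Ux; elim: r => [|i r IH].
  rewrite big_nil; under [X in partial k X]eq_fun do rewrite big_nil.
  exact: partial_cst.
rewrite big_cons; under [X in partial k X]eq_fun do rewrite big_cons.
case: (P i) => //; rewrite partialD ?IH //; first exact: smooth_diff Ux (sF i).
by apply: smooth_diff Ux _; exact: smooth_sum.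
Qed.

End SmoothFunctions.

(** * Symmetry of second derivatives *)

Lemma is_derive_line (R : realType) (V W : normedModType R) (F : V -> W)
    (x v : V) (t : R) :
  differentiable F (x + t *: v) ->
  is_derive t 1 (fun s : R => F (x + s *: v)) ('D_v F (x + t *: v)).
Proof.
move=> dF.
have E : (fun h : R => h^-1 *: (F (x + (h *: 1 + t) *: v) - F (x + t *: v)))
  = (fun h : R => h^-1 *: ((F \o shift (x + t *: v)) (h *: v) - F (x + t *: v))).
  apply/funext => h /=; congr (_ *: (F _ - _)).
  by rewrite scalerDl [h *: 1]mulr1 addrCA addrA addrC addrA.
have D : derivable F (x + t *: v) v by exact: diff_derivable.
rewrite /derivable -E in D.
by apply: DeriveDef => //; rewrite /derive -E.
Qed.

Section Schwarz.
Context (R : realType) (n : nat) (U : set 'rV[R]_n).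
Context (openU : open U).
Implicit Types (u v : 'rV[R]_n -> R) (x : 'rV[R]_n).
Let e_ (i : 'I_n) : 'rV[R]_n := delta_mx 0 i.

(** The mean value theorem is applied along e_i and then along e_j.  The second
    difference on the left is symmetric in i and j while the mixed derivative on
    the right is not. *)
Lemma second_difference u i j x (h : R) : 0 < h ->
  (forall s t, 0 <= s <= h -> 0 <= t <= h -> U (x + s *: e_ i + t *: e_ j)) ->
  smooth_on U u ->
  exists s t, [/\ 0 <= s <= h, 0 <= t <= h &
   u (x + h *: e_ i + h *: e_ j) - u (x + h *: e_ i) -
   (u (x + h *: e_ j) - u x) =
   partial j (partial i u) (x + s *: e_ i + t *: e_ j) * h ^+ 2].
Proof.
move=> h0 sq su.
have hh : 0 <= h <= h by rewrite lexx ltW.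
have h00 : 0 <= (0 : R) <= h by rewrite lexx ltW.
pose phi (s : R) := u (x + s *: e_ i + h *: e_ j) - u (x + s *: e_ i).
pose dphi (s : R) := partial i u (x + s *: e_ i + h *: e_ j)
  - partial i u (x + s *: e_ i).
have dphiP s : 0 <= s <= h -> is_derive s 1 phi (dphi s).
  move=> sh; apply: is_deriveB.
    have -> : (fun s : R => u (x + s *: e_ i + h *: e_ j)) =
      (fun s => u ((x + h *: e_ j) + s *: e_ i)).
      by apply/funext => r; rewrite addrAC.
    rewrite addrAC; apply: is_derive_line; rewrite addrAC.
    exact: smooth_diff (sq _ _ sh hh) su.
  apply: is_derive_line; apply: smooth_diff su.
  by have := sq s 0 sh h00; rewrite scale0r addr0.
have [s sI phiE] : exists2 s, s \in `]0, h[ & phi h - phi 0 = dphi s * (h - 0).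
  apply: (@MVT R phi dphi 0 h h0) => [s|].
    by rewrite in_itv /= => /andP[s0 sh]; apply: dphiP; rewrite !ltW.
  apply: derivable_within_continuous => s; rewrite in_itv /= => sI.
  by have [] := dphiP s sI.
have sh : 0 <= s <= h by move: sI; rewrite in_itv /= => /andP[? ?]; rewrite !ltW.
pose psi (t : R) := partial i u (x + s *: e_ i + t *: e_ j).
have dpsiP t : 0 <= t <= h ->
    is_derive t 1 psi (partial j (partial i u) (x + s *: e_ i + t *: e_ j)).
  move=> th; apply: is_derive_line; apply: smooth_diff (sq _ _ sh th) _.
  exact: smooth_partial.
have [t tI psiE] : exists2 t, t \in `]0, h[ & psi h - psi 0 =
    partial j (partial i u) (x + s *: e_ i + t *: e_ j) * (h - 0).
  apply: (@MVT R psi (fun t => partial j (partial i u) (x + s *: e_ i + t *: e_ j))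
    0 h h0) => [t|].
    by rewrite in_itv /= => /andP[t0 th]; apply: dpsiP; rewrite !ltW.
  apply: derivable_within_continuous => t; rewrite in_itv /= => tI.
  by have [] := dpsiP t tI.
exists s, t; split => //.
  by move: tI; rewrite in_itv /= => /andP[? ?]; rewrite !ltW.
rewrite expr2 mulrA; move: psiE phiE; rewrite !subr0 => <-.
by rewrite /phi /dphi /psi !scale0r !addr0.
Qed.

(** Schwarz's theorem: by [second_difference] the two mixed derivatives take a
    common value at two points as close to x as desired, and both are
    continuous. *)
Lemma partialC i j u x : smooth_on U u -> U x ->
  partial i (partial j u) x = partial j (partial i u) x.
Proof.
move=> su Ux; apply/eqP; rewrite -subr_eq0; apply/eqP/normr0_eq0/eqP.
rewrite eq_le normr_ge0 andbT; apply/ler_addgt0Pr => e e0; rewrite add0r.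
have cont k l : {for x, continuous (partial k (partial l u))}.
  apply: differentiable_continuous; apply: smooth_diff Ux _.
  by do 2 apply: smooth_partial.
have e20 : 0 < e / 2 by rewrite divr_gt0.
have close k l : \forall y \near x,
    `|partial k (partial l u) x - partial k (partial l u) y| < e / 2.
  by have /cvgrPdist_lt := cont k l; exact.
have Unear : \forall y \near x, U y by exact: open_nbhs_nbhs.
have F := nbhs_filter x.
have /nbhs_ballP [r /= r0 rP] :=
  @filterI _ _ F _ _ Unear (@filterI _ _ F _ _ (close i j) (close j i)).
(* a square of side r / 4 with corner x lies in the ball of radius r *)
pose h := r / 4.
have h0 : 0 < h by rewrite divr_gt0.
have inball k l s t : 0 <= s <= h -> 0 <= t <= h ->
    ball x r (x + s *: e_ k + t *: e_ l).
  move=> /andP[s0 sh] /andP[t0 th].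
  rewrite -ball_normE /ball_ /= -addrA opprD addNKr -normrN opprK.
  apply: le_lt_trans (ler_normD _ _) _; rewrite !normrZ.
  have ne m : `|e_ m| <= 1.
    rewrite /e_ [X in X <= _]mx_normrE; apply/bigmax_leP; split => //= -[a b] _.
    by rewrite mxE; case: (_ && _); rewrite ?normr1 ?normr0.
  have : `|s| * `|e_ k| + `|t| * `|e_ l| <= h + h.
    rewrite !ger0_norm //; apply: lerD.
      by rewrite -[h]mulr1; apply: ler_pM.
    by rewrite -[h]mulr1; apply: ler_pM.
  by move/le_lt_trans; apply; rewrite /h; lra.
have sqij k l s t : 0 <= s <= h -> 0 <= t <= h -> U (x + s *: e_ k + t *: e_ l).
  by move=> sh th; have [] := rP _ (inball k l s t sh th).
have [s1 [t1 [sh1 th1]]] := second_difference h0 (sqij i j) su.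
have [_ [_]] := rP _ (inball i j _ _ sh1 th1).
move: (x + s1 *: e_ i + t1 *: e_ j) => y A1 E1.
have [s2 [t2 [sh2 th2]]] := second_difference h0 (sqij j i) su.
have [_ [A2 _]] := rP _ (inball j i _ _ sh2 th2).
move: (x + s2 *: e_ j + t2 *: e_ i) A2 => z A2 E2.
have E : partial j (partial i u) y = partial i (partial j u) z.
  have h20 : h ^+ 2 != 0 by rewrite expf_neq0 // gt_eqF.
  have alg (a b c d : R) : a - b - (c - d) = a - c - (b - d) by ring.
  apply: (mulIf h20); apply: etrans (esym E1) _; rewrite alg.
  by rewrite [x + h *: e_ i + _]addrAC; exact: E2.
rewrite E in A1; rewrite ltW // [e]splitr.
apply: le_lt_trans (ltrD A2 A1); apply: le_trans (ler_normB _ _).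
by rewrite opprB addrA subrK.
Qed.

End Schwarz.

(** * Smooth matrix-valued functions *)

HB.lock Definition partial_mx (R : realType) (n p q : nat) (k : 'I_n)
    (F : 'rV[R]_n -> 'M[R]_(p, q)) (x : 'rV[R]_n) : 'M[R]_(p, q) :=
  \matrix_(i, j) partial k (fun y => F y i j) x.

Section MatrixFields.
Context (R : realType) (n : nat) (U : set 'rV[R]_n).
Context (openU : open U).
Implicit Types (x : 'rV[R]_n) (k l : 'I_n).

Definition smooth_mx p q (F : 'rV[R]_n -> 'M[R]_(p, q)) :=
  forall i j, smooth_on U (fun y => F y i j).

Lemma partial_mxE p q k (F : 'rV[R]_n -> 'M[R]_(p, q)) x i j :
  partial_mx k F x i j = partial k (fun y => F y i j) x.
Proof. by rewrite partial_mx.unlock mxE. Qed.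

Lemma partial_mx_local p q k (F H : 'rV[R]_n -> 'M[R]_(p, q)) x :
  (forall y, U y -> F y = H y) -> U x -> partial_mx k F x = partial_mx k H x.
Proof.
move=> FH Ux; apply/matrixP => i j; rewrite !partial_mxE.
by apply: (partial_local openU) Ux => y Uy; rewrite FH.
Qed.

Lemma smooth_partial_mx p q k (F : 'rV[R]_n -> 'M[R]_(p, q)) :
  smooth_mx F -> smooth_mx (partial_mx k F).
Proof.
move=> sF i j; apply: (smooth_local openU _ (smooth_partial k (sF i j))) => x _.
by rewrite partial_mxE.
Qed.

Lemma smooth_mxM p q r (F : 'rV[R]_n -> 'M[R]_(p, q))
    (H : 'rV[R]_n -> 'M[R]_(q, r)) :
  smooth_mx F -> smooth_mx H -> smooth_mx (fun y => F y *m H y).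
Proof.
move=> sF sH i j.
have S m : smooth_on U (fun y => F y i m * H y m j) by exact: smoothM.
apply: (smooth_local openU _ (smooth_sum openU _ _ S)) => x _.
by rewrite mxE.
Qed.

Lemma smooth_mxD p q (F H : 'rV[R]_n -> 'M[R]_(p, q)) :
  smooth_mx F -> smooth_mx H -> smooth_mx (fun y => F y + H y).
Proof.
move=> sF sH i j; apply: (smooth_local openU _ (smoothD openU (sF i j) (sH i j))).
by move=> x _; rewrite mxE.
Qed.

Lemma smooth_mxN p q (F : 'rV[R]_n -> 'M[R]_(p, q)) :
  smooth_mx F -> smooth_mx (fun y => - F y).
Proof.
move=> sF i j; apply: (smooth_local openU _ (smoothN openU (sF i j))).
by move=> x _; rewrite mxE.
Qed.

Lemma smooth_mx_tr p q (F : 'rV[R]_n -> 'M[R]_(p, q)) :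
  smooth_mx F -> smooth_mx (fun y => (F y)^T).
Proof.
move=> sF i j; apply: (smooth_local openU _ (sF j i)).
by move=> x _; rewrite mxE.
Qed.

Lemma partial_mxM p q r k (F : 'rV[R]_n -> 'M[R]_(p, q))
    (H : 'rV[R]_n -> 'M[R]_(q, r)) x :
  smooth_mx F -> smooth_mx H -> U x ->
  partial_mx k (fun y => F y *m H y) x =
  partial_mx k F x *m H x + F x *m partial_mx k H x.
Proof.
move=> sF sH Ux; apply/matrixP => i j; rewrite partial_mxE !mxE -big_split /=.
under [X in partial k X]eq_fun do rewrite mxE.
rewrite (partial_sum openU) //; last by move=> m; exact: smoothM.
apply: eq_bigr => m _; rewrite !partial_mxE partialM //.
  exact: smooth_diff Ux (sF i m).
exact: smooth_diff Ux (sH m j).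
Qed.

Lemma partial_mxD p q k (F H : 'rV[R]_n -> 'M[R]_(p, q)) x :
  smooth_mx F -> smooth_mx H -> U x ->
  partial_mx k (fun y => F y + H y) x = partial_mx k F x + partial_mx k H x.
Proof.
move=> sF sH Ux; apply/matrixP => i j; rewrite !(mxE, partial_mxE).
under [X in partial k X]eq_fun do rewrite mxE.
by rewrite partialD //; [exact: smooth_diff Ux (sF i j)|exact: smooth_diff Ux (sH i j)].
Qed.

Lemma partial_mxN p q k (F : 'rV[R]_n -> 'M[R]_(p, q)) x :
  smooth_mx F -> U x -> partial_mx k (fun y => - F y) x = - partial_mx k F x.
Proof.
move=> sF Ux; apply/matrixP => i j; rewrite !(mxE, partial_mxE).
under [X in partial k X]eq_fun do rewrite mxE.
by rewrite partialN //; exact: smooth_diff Ux (sF i j).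
Qed.

Lemma partial_mx_tr p q k (F : 'rV[R]_n -> 'M[R]_(p, q)) x :
  partial_mx k (fun y => (F y)^T) x = (partial_mx k F x)^T.
Proof.
apply/matrixP => i j; rewrite [RHS]mxE !partial_mxE.
by congr (partial k _ x); apply/funext => y; rewrite mxE.
Qed.

Lemma partial_mxC p q k l (F : 'rV[R]_n -> 'M[R]_(p, q)) x :
  smooth_mx F -> U x ->
  partial_mx k (partial_mx l F) x = partial_mx l (partial_mx k F) x.
Proof.
move=> sF Ux; apply/matrixP => i j.
have E a b : partial_mx a (partial_mx b F) x i j =
    partial a (partial b (fun y => F y i j)) x.
  rewrite partial_mxE; congr (partial a _ x).
  by apply/funext => y; rewrite partial_mxE.
apply: etrans (E k l) _; apply: etrans _ (esym (E l k)).
exact: (partialC openU).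
Qed.

Lemma partial_mxtrace p k (F : 'rV[R]_n -> 'M[R]_p) x :
  smooth_mx F -> U x ->
  partial k (fun y => \tr (F y)) x = \tr (partial_mx k F x).
Proof.
move=> sF Ux; rewrite /mxtrace (partial_sum openU) //.
by apply: eq_bigr => i _; rewrite partial_mxE.
Qed.

Lemma smooth_det p (F : 'rV[R]_n -> 'M[R]_p) :
  smooth_mx F -> smooth_on U (fun y => \det (F y)).
Proof.
move=> sF; apply: (smooth_sum openU) => s; apply: (smoothM openU).
  exact: smooth_cst.
by apply: (smooth_prod openU) => i; exact: sF.
Qed.

Lemma smooth_invmx p (F : 'rV[R]_n -> 'M[R]_p) :
  (forall x, U x -> F x \in unitmx) -> smooth_mx F ->
  smooth_mx (fun y => invmx (F y)).
Proof.
move=> uF sF i j.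
have s1 : smooth_on U (fun y => (\det (F y))^-1).
  apply: (smoothV openU) (smooth_det sF) => x /uF.
  by rewrite unitmxE unitfE.
have s2 : smooth_on U (fun y => cofactor (F y) j i).
  apply: (smoothM openU); first exact: smooth_cst.
  apply: smooth_det => a b.
  apply: (smooth_local openU _ (sF (lift j a) (lift i b))) => x _.
  by rewrite !mxE.
apply: (smooth_local openU _ (smoothM openU s1 s2)) => x Ux.
by rewrite /invmx uF // !mxE.
Qed.

Lemma partial_invmx p k (F : 'rV[R]_n -> 'M[R]_p) x :
  (forall x, U x -> F x \in unitmx) -> smooth_mx F -> U x ->
  partial_mx k (fun y => invmx (F y)) x =
  - (invmx (F x) *m partial_mx k F x *m invmx (F x)).
Proof.
move=> uF sF Ux.
have sI := smooth_invmx uF sF.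
have D : partial_mx k (fun y => invmx (F y) *m F y) x = 0.
  rewrite (@partial_mx_local _ _ k _ (fun=> 1%:M) x) // => [|y Uy].
    by apply/matrixP => i j; rewrite partial_mxE partial_cst mxE.
  by rewrite mulVmx // uF.
move: D; rewrite partial_mxM // => /eqP; rewrite addr_eq0 => /eqP D.
by rewrite -mulNmx -D mulmxK // uF.
Qed.

End MatrixFields.

(** * Matrix identities behind the curvature symmetries *)

Section MatrixIdentities.
Context (R : realFieldType) (n : nat).
Implicit Types (G A B C D E S : 'M[R]_n).

Lemma addmxE p q (A B : 'M[R]_(p, q)) i j : (A + B) i j = A i j + B i j.
Proof. by rewrite mxE. Qed.

Lemma oppmxE p q (A : 'M[R]_(p, q)) i j : (- A) i j = - A i j.
Proof. by rewrite mxE. Qed.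

Lemma trmxD p q (A B : 'M[R]_(p, q)) : (A + B)^T = A^T + B^T.
Proof. exact: raddfD. Qed.

Lemma trmxN p q (A : 'M[R]_(p, q)) : (- A)^T = - A^T.
Proof. exact: raddfN. Qed.

Definition mx_expand := (@mulmxDl R, @mulmxDr R, @mulmxBl R, @mulmxBr R,
  @mulNmx R, @mulmxN R, trmxD, trmxN, @trmx_mul R, @mulmxA R).

(** Here A = A_i, B = A_j, P = d_i A_j and Q = d_j A_i: the hypothesis is
    d_i d_j G = d_j d_i G, expanded by metric compatibility, and the conclusion
    is that the curvature is skew for G. *)
Lemma skew_algebra G A B P Q :
  P *m G + B *m (A *m G + G *m A^T) + ((A *m G + G *m A^T) *m B^T + G *m P^T) =
  Q *m G + A *m (B *m G + G *m B^T) + ((B *m G + G *m B^T) *m A^T + G *m Q^T) ->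
  (P - Q + B *m A - A *m B) *m G + G *m (P - Q + B *m A - A *m B)^T = 0.
Proof.
move=> /matrixP H; apply/matrixP => i j; move: {H} (H i j).
rewrite !mx_expand !(addmxE, oppmxE) ![(0 : 'M[R]_n) i j]mxE => H; lra.
Qed.

(** Here A = A_k, S is a curvature matrix and D = d_k S: the second hypothesis is
    the derivative of the first, and the conclusion is that the covariant
    derivative of S is again skew for G. *)
Lemma skew_deriv_algebra G A S D :
  S *m G + G *m S^T = 0 ->
  D *m G + S *m (A *m G + G *m A^T) + ((A *m G + G *m A^T) *m S^T + G *m D^T) = 0
  -> (D - A *m S + S *m A) *m G + G *m (D - A *m S + S *m A)^T = 0.
Proof.
move=> H1 /matrixP H2.
have /matrixP H3 : (S *m G + G *m S^T) *m A^T = 0 by rewrite H1 mul0mx.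
have /matrixP H4 : A *m (S *m G + G *m S^T) = 0 by rewrite H1 mulmx0.
apply/matrixP => i j; move: {H2} (H2 i j) {H3} (H3 i j) {H4} (H4 i j).
rewrite !mx_expand !(addmxE, oppmxE) ![(0 : 'M[R]_n) i j]mxE => *; lra.
Qed.

(** A, B, C are the connection matrices along three directions a, b, c.  A name
    such as AB stands for d_a B, and XC for d_a d_b C; the three summands are the
    derivatives d - [A, -] of the curvature matrices, permuted cyclically. *)
Lemma bianchi_algebra A B C AB AC BA BC CA CB XA XB XC :
  (XC - XB + (AC *m B + C *m AB) - (AB *m C + B *m AC)
    - A *m (BC - CB + C *m B - B *m C) + (BC - CB + C *m B - B *m C) *m A)
  + (XA - XC + (BA *m C + A *m BC) - (BC *m A + C *m BA)
    - B *m (CA - AC + A *m C - C *m A) + (CA - AC + A *m C - C *m A) *m B)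
  + (XB - XA + (CB *m A + B *m CA) - (CA *m B + A *m CB)
    - C *m (AB - BA + B *m A - A *m B) + (AB - BA + B *m A - A *m B) *m C)
  = 0.
Proof.
apply/matrixP => i j.
rewrite !mx_expand !(addmxE, oppmxE) [RHS]mxE; ring.
Qed.

Lemma mxtrace_mul_tr p q (A B : 'M[R]_(p, q)) :
  \tr (A *m B^T) = \sum_i \sum_j A i j * B i j.
Proof.
apply: eq_bigr => i _; rewrite mxE.
by apply: eq_bigr => j _; rewrite mxE.
Qed.

End MatrixIdentities.

(** * Levi-Civita connection and curvature *)

(** The matrix A_k acts on the components of covectors: the covariant derivative
    of w along k is d_k w - A_k w. *)
HB.lock Definition connection (R : realType) (n : nat)
    (G : 'rV[R]_n -> 'M[R]_n) (k : 'I_n) (x : 'rV[R]_n) : 'M[R]_n :=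
  \matrix_(i, m) christoffel G m k i x.

Lemma connectionE (R : realType) (n : nat) (G : 'rV[R]_n -> 'M[R]_n)
    (k : 'I_n) (x : 'rV[R]_n) (i m : 'I_n) :
  connection G k x i m = christoffel G m k i x.
Proof. by rewrite connection.unlock mxE. Qed.

(** The entry (k, m) is R_ijk^m.  The commutator has the opposite of the usual
    sign because the covariant derivative is d - A. *)
HB.lock Definition curvature (R : realType) (n : nat)
    (G : 'rV[R]_n -> 'M[R]_n) (i j : 'I_n) (x : 'rV[R]_n) : 'M[R]_n :=
  partial_mx i (connection G j) x - partial_mx j (connection G i) x
  + connection G j x *m connection G i x - connection G i x *m connection G j x.

(** The full covariant derivative of R_ijk^m: the first two lines differentiate
    the indices k and m, the two sums the indices i and j. *)
HB.lock Definition cov_curvature (R : realType) (n : nat)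
    (G : 'rV[R]_n -> 'M[R]_n) (a i j : 'I_n) (x : 'rV[R]_n) : 'M[R]_n :=
  partial_mx a (curvature G i j) x - connection G a x *m curvature G i j x
  + curvature G i j x *m connection G a x
  - \sum_m christoffel G m a i x *: curvature G m j x
  - \sum_m christoffel G m a j x *: curvature G i m x.

Record metric_on (R : realType) (n : nat) (U : set 'rV[R]_n)
    (G : 'rV[R]_n -> 'M[R]_n) : Prop := MetricOn {
  metric_on_open : open U;
  metric_on_smooth : smooth_mx U G;
  metric_on_sym : forall x, U x -> (G x)^T = G x;
  metric_on_unit : forall x, U x -> G x \in unitmx
}.

Section LocalMetric.
Context (R : realType) (n : nat) (U : set 'rV[R]_n) (G : 'rV[R]_n -> 'M[R]_n).
Context (gU : metric_on U G).
Let openU : open U := metric_on_open gU.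
Let smoothG : smooth_mx U G := metric_on_smooth gU.
Let symG : forall x, U x -> (G x)^T = G x := metric_on_sym gU.
Let unitG : forall x, U x -> G x \in unitmx := metric_on_unit gU.
Implicit Types (x : 'rV[R]_n) (i j k l m a : 'I_n)
  (h : 'I_n -> 'I_n -> 'rV[R]_n -> R) (w : 'I_n -> 'rV[R]_n -> R).

#[local] Notation connection := (connection G).

#[local] Notation curvature := (curvature G).
#[local] Notation cov_curvature := (cov_curvature G).

Definition tensor2_mx h x : 'M[R]_n := \matrix_(i, j) h i j x.

Definition smooth2 h := forall i j, smooth_on U (h i j).

Lemma smooth_lower i j : smooth_on U (lower_g G i j).
Proof. exact: smoothG. Qed.

Lemma smooth_upper i j : smooth_on U (upper_g G i j).
Proof. exact: (smooth_invmx openU unitG smoothG i j). Qed.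

Lemma smooth_christoffel m k i : smooth_on U (christoffel G m k i).
Proof.
apply: (smoothM openU); first exact: smooth_cst.
apply: (smooth_sum openU) => l; apply: (smoothM openU) (smooth_upper m l) _.
apply: (smoothD openU).
  by apply: (smoothD openU); apply: smooth_partial; exact: smooth_lower.
by apply: (smoothN openU); apply: smooth_partial; exact: smooth_lower.
Qed.

Lemma smooth_connection k : smooth_mx U (connection k).
Proof.
move=> i m; apply: (smooth_local openU _ (smooth_christoffel m k i)) => x _.
by rewrite connectionE.
Qed.

Lemma smooth_curvature i j : smooth_mx U (curvature i j).
Proof.
have sc := smooth_connection.
have sp a b := smooth_partial_mx openU a (sc b).
have sm a b := smooth_mxM openU (sc a) (sc b).
rewrite curvature.unlock.
do 2 (apply: smooth_mxD => //; try exact: smooth_mxN).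
by apply: smooth_mxD => //; exact: smooth_mxN.
Qed.

Lemma upper_sym i j x : U x -> upper_g G i j x = upper_g G j i x.
Proof. by move=> Ux; rewrite /upper_g -[in LHS](symG Ux) -trmx_inv mxE. Qed.

Lemma lower_sym i j x : U x -> lower_g G i j x = lower_g G j i x.
Proof. by move=> Ux; rewrite /lower_g -[in LHS](symG Ux) mxE. Qed.

Lemma partial_lower_sym k i j x : U x ->
  partial k (lower_g G i j) x = partial k (lower_g G j i) x.
Proof. by apply: (partial_local openU) => y Uy; exact: lower_sym. Qed.

Lemma christoffel_sym m i j x : U x ->
  christoffel G m i j x = christoffel G m j i x.
Proof.
move=> Ux; congr (_ * _); apply: eq_bigr => l _; congr (_ * _).
rewrite (partial_lower_sym l i j Ux); congr (_ - _); exact: addrC.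
Qed.

(** Lowering the index cancels the inverse metric of the Christoffel symbols. *)
Lemma connection_lower k x i j : U x -> (connection k x *m G x) i j =
  2^-1 * (partial k (lower_g G i j) x + partial i (lower_g G k j) x
          - partial j (lower_g G k i) x).
Proof.
move=> Ux.
pose K := \row_l (partial k (lower_g G i l) x + partial i (lower_g G k l) x
          - partial l (lower_g G k i) x).
have E : row i (connection k x) = 2^-1 *: (K *m invmx (G x)).
  apply/rowP => m; rewrite mxE connectionE !mxE; congr (_ * _); apply: eq_bigr => l _.
  rewrite mulrC !mxE; congr (_ * _); exact: upper_sym.
transitivity ((row i (connection k x) *m G x) 0 j).
  by rewrite -row_mul [RHS]mxE.
by rewrite E -scalemxAl mulmxKV ?unitG // !mxE.
Qed.

(** The metric is parallel: in the sum of the two lowered Christoffel symbols only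
    the derivative along k survives. *)
Lemma partial_metric k x : U x ->
  partial_mx k G x = connection k x *m G x + G x *m (connection k x)^T.
Proof.
move=> Ux; apply/matrixP => i j.
have -> : G x *m (connection k x)^T = (connection k x *m G x)^T.
  by rewrite trmx_mul symG.
rewrite addmxE [in X in _ = _ + X]mxE !connection_lower // partial_mxE.
have E : partial k (lower_g G j i) x = partial k (lower_g G i j) x.
  exact: partial_lower_sym.
rewrite -/(lower_g G i j) E; move: (partial k _ x) (partial i _ x) (partial j _ x).
by move=> a b c; field.
Qed.

Lemma partial_upper k x : U x ->
  partial_mx k (fun y => invmx (G y)) x =
  - (invmx (G x) *m connection k x + (connection k x)^T *m invmx (G x)).
Proof.
move=> Ux; rewrite (partial_invmx openU k unitG smoothG Ux) partial_metric //.
by rewrite !mulmxDr mulmxDl !mulmxA mulVmx ?unitG // mul1mx mulmxK ?unitG.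
Qed.

Lemma partial_connection_metric i j x : U x ->
  partial_mx i (fun y => connection j y *m G y + G y *m (connection j y)^T) x =
  partial_mx i (connection j) x *m G x
  + connection j x *m (connection i x *m G x + G x *m (connection i x)^T)
  + ((connection i x *m G x + G x *m (connection i x)^T) *m (connection j x)^T
  + G x *m (partial_mx i (connection j) x)^T).
Proof.
move=> Ux; have sc := smooth_connection j; have sct := smooth_mx_tr openU sc.
rewrite (@partial_mxD _ _ U) //; try exact: (smooth_mxM openU).
rewrite !(partial_mxM openU) // partial_mx_tr partial_metric //.
Qed.

(** The second derivatives of the metric commute. *)
Lemma curvature_skew i j x : U x ->
  curvature i j x *m G x + G x *m (curvature i j x)^T = 0.
Proof.
rewrite curvature.unlock => Ux.
apply: (@skew_algebra _ _ (G x) (connection i x) (connection j x)).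
apply: etrans (esym (partial_connection_metric i j Ux)) _.
apply: etrans _ (partial_connection_metric j i Ux).
have E a b : partial_mx a (partial_mx b G) x =
  partial_mx a (fun y => connection b y *m G y + G y *m (connection b y)^T) x.
  by apply: (partial_mx_local openU) Ux => y Uy; exact: partial_metric.
apply: etrans (esym (E i j)) _; apply: etrans _ (E j i).
exact: (partial_mxC openU).
Qed.

Lemma curvature_antisym i j x : curvature i j x = - curvature j i x.
Proof.
rewrite curvature.unlock.
move: (partial_mx i _ x) (partial_mx j _ x) (connection i x *m _) (_ *m connection i x).
move=> A B C D.
by apply/matrixP => a b; rewrite !(addmxE, oppmxE); ring.
Qed.

Lemma riemann_upE i j k m x : riemann_up G i j k m x = curvature i j x k m.
Proof.
rewrite curvature.unlock !(addmxE, oppmxE) !partial_mxE /riemann_up.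
rewrite -[RHS]addrA; congr (_ + _).
  have E a b : partial a (fun y => connection b y k m) x =
      partial a (christoffel G m b k) x.
    by congr (partial a _ x); apply/funext => y; rewrite connectionE.
  by rewrite !E.
rewrite !mxE -sumrB; apply: eq_bigr => p _.
by rewrite !connectionE.
Qed.

Lemma upper_lower k m x : U x ->
  \sum_l upper_g G k l x * lower_g G l m x = (k == m)%:R.
Proof.
by move=> Ux; have /matrixP/(_ k m) := mulVmx (unitG Ux); rewrite !mxE.
Qed.

Lemma raise_lower (F : 'I_n -> R) k x : U x ->
  \sum_l upper_g G k l x * (\sum_m lower_g G l m x * F m) = F k.
Proof.
move=> Ux.
transitivity (\sum_m (\sum_l upper_g G k l x * lower_g G l m x) * F m).
  under eq_bigr do rewrite mulr_sumr.
  rewrite exchange_big /=; apply: eq_bigr => m _; rewrite mulr_suml.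
  by apply: eq_bigr => l _; rewrite mulrA.
under eq_bigr do rewrite upper_lower //.
rewrite (bigD1 k) //= eqxx mul1r big1 ?addr0 // => m /negPf mk.
by rewrite eq_sym mk mul0r.
Qed.

(** The inverse metric in the definition of the Ricci tensor undoes the lowering
    of the last index of the Riemann tensor. *)
Lemma ricciE i j x : U x -> ricci G i j x = \sum_k curvature k i x j k.
Proof.
move=> Ux; apply: eq_bigr => k _.
by rewrite (raise_lower (fun m => riemann_up G k i j m x)) // riemann_upE.
Qed.

Lemma trace_gE h x : trace_g G h x = \tr (invmx (G x) *m (tensor2_mx h x)^T).
Proof.
rewrite mxtrace_mul_tr; apply: eq_bigr => i _; apply: eq_bigr => j _.
by rewrite mxE.
Qed.

Lemma cov2_mx h k x : tensor2_mx (cov2 G h k) x =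
  partial_mx k (tensor2_mx h) x - connection k x *m tensor2_mx h x
  - tensor2_mx h x *m (connection k x)^T.
Proof.
apply/matrixP => i j; rewrite !(addmxE, oppmxE) partial_mxE mxE /cov2.
congr (_ - _ - _).
- by congr (partial _ _ _); apply/funext => y; rewrite mxE.
- by rewrite mxE; apply: eq_bigr => m _; rewrite connectionE mxE.
- by rewrite mxE; apply: eq_bigr => m _; rewrite !mxE connectionE mulrC.
Qed.

(** The inverse metric is parallel, so that the metric trace commutes with
    covariant differentiation. *)
Lemma partial_trace h k x : smooth2 h -> U x ->
  partial k (trace_g G h) x = trace_g G (cov2 G h k) x.
Proof.
move=> sh Ux; rewrite trace_gE cov2_mx.
have sH : smooth_mx U (tensor2_mx h).
  by move=> i j; apply: (smooth_local openU _ (sh i j)) => y _; rewrite mxE.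
have sHt := smooth_mx_tr openU sH.
have sI := smooth_invmx openU unitG smoothG.
rewrite (_ : trace_g G h = fun y => \tr (invmx (G y) *m (tensor2_mx h y)^T)).
  rewrite (partial_mxtrace openU) //; last exact: smooth_mxM.
  rewrite (partial_mxM openU) // partial_upper // partial_mx_tr.
  move: (partial_mx k _ x) (connection k x) (tensor2_mx h x) (invmx _).
  move=> P C H I.
  rewrite !mx_expand trmxK !raddfD /= !raddfN /= -[C^T *m I *m H^T]mulmxA.
  rewrite [\tr (C^T *m _)]mxtrace_mulC; ring.
by apply/funext => y; rewrite trace_gE.
Qed.


Lemma partial_christoffel_sym k m i j x : U x ->
  partial k (christoffel G m i j) x = partial k (christoffel G m j i) x.
Proof. by apply: (partial_local openU) => y Uy; exact: christoffel_sym. Qed.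

(** As the connection is torsion free, the derivatives of the Christoffel symbols
    cancel in pairs, and so do the quadratic terms. *)
Lemma first_bianchi i j k m x : U x ->
  riemann_up G i j k m x + riemann_up G j k i m x + riemann_up G k i j m x = 0.
Proof.
move=> Ux; rewrite /riemann_up.
have E1 := partial_christoffel_sym i m k j Ux.
have E2 := partial_christoffel_sym j m k i Ux.
have E3 := partial_christoffel_sym k m j i Ux.
rewrite E1 E2 E3.
have alg (a b c s1 s2 s3 : R) :
  a - b + s1 + (b - c + s2) + (c - a + s3) = s1 + s2 + s3 by ring.
have alg2 (c : 'I_n -> 'I_n -> 'I_n -> R) : (forall m i j, c m i j = c m j i) ->
    \sum_p (c p j k * c m i p - c p i k * c m j p)
    + \sum_p (c p k i * c m j p - c p j i * c m k p)
    + \sum_p (c p i j * c m k p - c p k j * c m i p) = 0.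
  move=> cC; rewrite -!big_split /=; apply: big1 => p _.
  rewrite (cC p k j) (cC p k i) (cC p j i); ring.
rewrite alg; apply: (alg2 (fun m i j => christoffel G m i j x)) => *.
exact: christoffel_sym.
Qed.

Definition skew_adjoint x (S : 'M[R]_n) := S *m G x + G x *m S^T = 0.

Lemma skew_adjointB x S T :
  skew_adjoint x S -> skew_adjoint x T -> skew_adjoint x (S - T).
Proof.
rewrite /skew_adjoint => sS sT; rewrite !mx_expand addrACA sS add0r.
by rewrite -opprD sT oppr0.
Qed.

Lemma skew_adjoint_sum x (c : 'I_n -> R) (S : 'I_n -> 'M[R]_n) :
  (forall m, skew_adjoint x (S m)) -> skew_adjoint x (\sum_m c m *: S m).
Proof.
rewrite /skew_adjoint => sS; rewrite raddf_sum mulmx_suml mulmx_sumr -big_split /=.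
apply: big1 => m _.
by rewrite linearZ /= -scalemxAl -scalemxAr -scalerDr sS scaler0.
Qed.

(** A matrix skew for G satisfies G^-1 S = - S^T G^-1. *)
Lemma raise_skew x S i k : U x -> skew_adjoint x S ->
  \sum_j upper_g G i j x * S j k = - \sum_j upper_g G k j x * S j i.
Proof.
move=> Ux /eqP; rewrite addr_eq0 => /eqP E.
have {}E : invmx (G x) *m S = - (S^T *m invmx (G x)).
  have uG := unitG Ux.
  by rewrite -[S in LHS](mulmxK uG) E !mulNmx mulmxN !mulmxA mulVmx // mul1mx.
move/matrixP: E => /(_ i k); rewrite oppmxE !mxE => ->; congr (- _).
by apply: eq_bigr => j _; rewrite mulrC mxE upper_sym.
Qed.

Lemma skew_trace0 x S : U x -> skew_adjoint x S -> \tr S = 0.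
Proof.
move=> Ux /eqP; rewrite addr_eq0 => /eqP E.
have uG := unitG Ux.
have : \tr S = - \tr S.
  rewrite -[in LHS](mulmxK uG S) E mulNmx raddfN /= mxtrace_mulC mulKmx //.
  by rewrite mxtrace_tr.
by move=> H; lra.
Qed.

(** By the first Bianchi identity Ric_ij - Ric_ji is minus the trace of the
    curvature matrix, which is skew for the metric. *)
Lemma ricci_sym i j x : U x -> ricci G i j x = ricci G j i x.
Proof.
move=> Ux; apply/eqP; rewrite -subr_eq0; apply/eqP.
rewrite !ricciE // -sumrB.
have := skew_trace0 Ux (curvature_skew i j Ux) => /eqP.
rewrite -oppr_eq0 => /eqP E; rewrite -[RHS]E /mxtrace -sumrN.
apply: eq_bigr => k _.
have := first_bianchi k i j k Ux; rewrite !riemann_upE.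
rewrite [curvature j k x]curvature_antisym oppmxE.
move: (curvature k i x j k) (curvature i j x k k) (curvature k j x i k).
by move=> *; lra.
Qed.

Lemma partial_curvature a i j x : U x ->
  partial_mx a (curvature i j) x =
  partial_mx a (partial_mx i (connection j)) x
  - partial_mx a (partial_mx j (connection i)) x
  + (partial_mx a (connection j) x *m connection i x
     + connection j x *m partial_mx a (connection i) x)
  - (partial_mx a (connection i) x *m connection j x
     + connection i x *m partial_mx a (connection j) x).
Proof.
move=> Ux.
have sc := smooth_connection.
have sp b c := smooth_partial_mx openU b (sc c).
have sm b c := smooth_mxM openU (sc b) (sc c).
have s1 := smooth_mxD openU (sp i j) (smooth_mxN openU (sp j i)).
have s2 := smooth_mxD openU s1 (sm j i).
rewrite curvature.unlock (partial_mxD a s2 (smooth_mxN openU (sm i j)) Ux).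
rewrite (partial_mxD a s1 (sm j i) Ux).
rewrite (partial_mxD a (sp i j) (smooth_mxN openU (sp j i)) Ux).
rewrite (partial_mxN a (sp j i) Ux) (partial_mxN a (sm i j) Ux).
rewrite (partial_mxM openU a (sc j) (sc i) Ux).
by rewrite (partial_mxM openU a (sc i) (sc j) Ux).
Qed.

(** In the cyclic sum the Christoffel terms of the two form indices cancel, the
    connection being torsion free; what is left is [bianchi_algebra]. *)
Lemma second_bianchi a i j x : U x ->
  cov_curvature a i j x + cov_curvature i j a x + cov_curvature j a i x = 0.
Proof.
move=> Ux.
pose L b k l := partial_mx b (curvature k l) x - connection b x *m curvature k l x
  + curvature k l x *m connection b x.
pose T b k l := \sum_m christoffel G m b k x *: curvature m l x.
have covE b k l : cov_curvature b k l x = L b k l - T b k l + T b l k.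
  rewrite cov_curvature.unlock; congr (_ + _); rewrite /T -sumrN; apply: eq_bigr => m _.
  by rewrite curvature_antisym scalerN opprK.
have TC b k l : T b k l = T k b l.
  by apply: eq_bigr => m _; rewrite christoffel_sym.
have L0 : L a i j + L i j a + L j a i = 0.
  rewrite /L !partial_curvature // curvature.unlock.
  have X b k l : partial_mx b (partial_mx k (connection l)) x =
    partial_mx k (partial_mx b (connection l)) x.
    exact: (partial_mxC openU b k (smooth_connection l) Ux).
  rewrite (X i j a) (X j a i) (X i a j).
  exact: bianchi_algebra.
rewrite !covE (TC j i a) (TC a j i) (TC i a j).
move: L0 (T i j a) (T j a i) (T a i j).
move: (L a i j) (L i j a) (L j a i) => A B C L0 X Y Z.
apply/matrixP => r s; move/matrixP: L0 => /(_ r s).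
by rewrite !(addmxE, oppmxE) ![(0 : 'M[R]_n) r s]mxE => H; lra.
Qed.

Lemma cov_curvature_antisym a i j x : U x ->
  cov_curvature a i j x = - cov_curvature a j i x.
Proof.
move=> Ux; rewrite cov_curvature.unlock.
have -> : partial_mx a (curvature i j) x = - partial_mx a (curvature j i) x.
  rewrite -(partial_mxN a (smooth_curvature j i) Ux).
  by apply: (partial_mx_local openU) Ux => y _; exact: curvature_antisym.
have E k l : \sum_m christoffel G m a k x *: curvature m l x =
    - \sum_m christoffel G m a k x *: curvature l m x.
  rewrite -sumrN; apply: eq_bigr => m _.
  by rewrite curvature_antisym scalerN.
rewrite (E i j) -[in LHS](opprK (\sum_m _ *: curvature i m x)) -(E j i).
rewrite (curvature_antisym i j).
move: (\sum_m _ *: curvature j m x) (\sum_m _ *: curvature m i x) => A B.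
move: (partial_mx a _ x) (connection a x) (curvature j i x) => P C S.
by apply/matrixP => r s; rewrite !mx_expand !(addmxE, oppmxE); ring.
Qed.

Lemma cov_curvature_skew a i j x : U x -> skew_adjoint x (cov_curvature a i j x).
Proof.
rewrite cov_curvature.unlock => Ux.
have cs b c := curvature_skew b c Ux.
do 2 (apply: skew_adjointB; last by apply: skew_adjoint_sum => m; exact: cs).
apply: skew_deriv_algebra; first exact: cs.
have sc := smooth_curvature i j; have sct := smooth_mx_tr openU sc.
rewrite -!partial_metric // -partial_mx_tr.
rewrite -(partial_mxM openU a sc smoothG Ux) -(partial_mxM openU a smoothG sct Ux).
have sM := smooth_mxM openU.
rewrite -(partial_mxD a (sM _ _ _ _ _ sc smoothG) (sM _ _ _ _ _ smoothG sct) Ux).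
have -> : partial_mx a (fun y => curvature i j y *m G y + G y *m (curvature i j y)^T) x
  = partial_mx a (fun=> 0) x.
  by apply: (partial_mx_local openU) Ux => y Uy; exact: curvature_skew.
by apply/matrixP => r s; rewrite partial_mxE partial_cst mxE.
Qed.

Lemma smooth_ricci : smooth2 (ricci G).
Proof.
move=> i j; have S k : smooth_on U (fun y => curvature k i y j k).
  exact: smooth_curvature.
apply: (smooth_local openU _ (smooth_sum openU _ _ S)) => y Uy.
by rewrite ricciE.
Qed.

(** Contraction commutes with covariant differentiation: the Christoffel terms of
    the two contracted indices cancel. *)
Lemma cov2_ricci a i j x : U x ->
  cov2 G (ricci G) a i j x = \sum_k cov_curvature a k i x j k.
Proof.
move=> Ux; rewrite /cov2.
have -> : partial a (ricci G i j) x = \sum_k partial_mx a (curvature k i) x j k.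
  have S k : smooth_on U (fun y => curvature k i y j k).
    exact: smooth_curvature.
  transitivity (partial a (fun y => \sum_k curvature k i y j k) x).
    by apply: (partial_local openU) Ux => y Uy; rewrite ricciE.
  rewrite (partial_sum openU _ _ _ S Ux); apply: eq_bigr => k _.
  by rewrite partial_mxE.
have covE k : cov_curvature a k i x j k =
  partial_mx a (curvature k i) x j k
  - \sum_m christoffel G m a j x * curvature k i x m k
  + \sum_m curvature k i x j m * christoffel G k a m x
  - \sum_m christoffel G m a k x * curvature m i x j k
  - \sum_m christoffel G m a i x * curvature k m x j k.
  rewrite cov_curvature.unlock !(addmxE, oppmxE); congr (_ - _ + _ - _ - _).
  - by rewrite mxE; apply: eq_bigr => m _; rewrite connectionE.
  - by rewrite mxE; apply: eq_bigr => m _; rewrite connectionE.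
  - by rewrite summxE; apply: eq_bigr => m _; rewrite mxE.
  - by rewrite summxE; apply: eq_bigr => m _; rewrite mxE.
under [RHS]eq_bigr do rewrite covE.
rewrite !(sumrB, big_split) /=.
have -> : \sum_k \sum_m curvature k i x j m * christoffel G k a m x =
  \sum_k \sum_m christoffel G m a k x * curvature m i x j k.
  rewrite exchange_big /=; apply: eq_bigr => k _; apply: eq_bigr => m _.
  exact: mulrC.
rewrite addrK [RHS]addrAC; congr (_ - _ - _).
  rewrite exchange_big /=; apply: eq_bigr => m _.
  by rewrite ricciE // mulr_sumr.
rewrite exchange_big /=; apply: eq_bigr => m _.
by rewrite ricciE // mulr_sumr.
Qed.

Lemma cov2_sym h a i j x : (forall i j y, U y -> h i j y = h j i y) -> U x ->
  cov2 G h a i j x = cov2 G h a j i x.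
Proof.
move=> hC Ux; rewrite /cov2.
have E : partial a (h i j) x = partial a (h j i) x.
  by apply: (partial_local openU) Ux => y; exact: hC.
rewrite E [LHS]addrAC; congr (_ - _ - _); apply: eq_bigr => m _; congr (_ * _);
  exact: hC.
Qed.

(** The second Bianchi identity is contracted twice.  Of its three terms one is
    the derivative of the scalar curvature, and the two others give the same
    divergence of Ric, one of them because the curvature is skew. *)
Lemma contracted_bianchi a x : U x ->
  partial a (scalar_curvature G) x = - 2 * delta2 G (ricci G) a x.
Proof.
move=> Ux; apply: etrans (partial_trace a smooth_ricci Ux) _.
pose div := \sum_i \sum_j upper_g G i j x * cov2 G (ricci G) i j a x.
have divE : delta2 G (ricci G) a x = - div by [].
rewrite divE mulrNN.
have B i j : cov2 G (ricci G) a i j x =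
    cov2 G (ricci G) i a j x - \sum_k cov_curvature k i a x j k.
  rewrite !cov2_ricci // -sumrB; apply: eq_bigr => k _.
  have /matrixP/(_ j k) := second_bianchi a k i Ux.
  rewrite (cov_curvature_antisym i a k Ux) !(addmxE, oppmxE) [RHS]mxE.
  move: (cov_curvature a k i x j k) (cov_curvature k i a x j k)
        (cov_curvature i k a x j k) => X Y Z H; lra.
have S1 : \sum_i \sum_j upper_g G i j x * cov2 G (ricci G) i a j x = div.
  apply: eq_bigr => i _; apply: eq_bigr => j _; apply: congr1.
  by apply: cov2_sym Ux => *; exact: ricci_sym.
have S2 : \sum_i \sum_j upper_g G i j x * (\sum_k cov_curvature k i a x j k)
    = - div.
  under eq_bigr => i _.
    under eq_bigr do rewrite mulr_sumr.
    rewrite exchange_big /=.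
    under eq_bigr => k _ do rewrite (raise_skew _ _ Ux (cov_curvature_skew k i a Ux)).
    rewrite sumrN.
    over.
  rewrite sumrN exchange_big /=; congr (- _); apply: eq_bigr => k _.
  rewrite exchange_big /=; apply: eq_bigr => j _.
  rewrite -mulr_sumr; congr (_ * _).
  apply: etrans (esym (cov2_ricci k a j Ux)) _.
  by apply: cov2_sym Ux => *; exact: ricci_sym.
rewrite /trace_g; under eq_bigr => i _ do under eq_bigr => j _ do
  rewrite B mulrBr.
under eq_bigr => i _ do rewrite sumrB.
rewrite sumrB S1 S2; ring.
Qed.

End LocalMetric.

(** * Derivatives and traces of tensors *)

Section TensorCalculus.
Context (R : realType) (n : nat) (U : set 'rV[R]_n) (G : 'rV[R]_n -> 'M[R]_n).
Context (gU : metric_on U G).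
Let openU : open U := metric_on_open gU.
Implicit Types (x : 'rV[R]_n) (i j k l m a : 'I_n) (u : 'rV[R]_n -> R)
  (h : 'I_n -> 'I_n -> 'rV[R]_n -> R) (w : 'I_n -> 'rV[R]_n -> R)
  (T : 'I_n -> 'I_n -> 'I_n -> 'rV[R]_n -> R).

Lemma cov1_local w w' k i x : (forall i, eq_on U (w i) (w' i)) -> U x ->
  cov1 G w k i x = cov1 G w' k i x.
Proof.
move=> E Ux; rewrite /cov1 (partial_local openU k (E i) Ux); congr (_ - _).
by apply: eq_bigr => m _; rewrite E.
Qed.

Lemma cov2_local h h' k i j x : (forall i j, eq_on U (h i j) (h' i j)) -> U x ->
  cov2 G h k i j x = cov2 G h' k i j x.
Proof.
move=> E Ux; rewrite /cov2 (partial_local openU k (E i j) Ux).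
by congr (_ - _ - _); apply: eq_bigr => m _; rewrite E.
Qed.

Lemma cov3_local T T' k a i j x :
  (forall a i j, eq_on U (T a i j) (T' a i j)) -> U x ->
  cov3 G T k a i j x = cov3 G T' k a i j x.
Proof.
move=> E Ux; rewrite /cov3 (partial_local openU k (E a i j) Ux).
by congr (_ - _ - _ - _); apply: eq_bigr => m _; rewrite E.
Qed.

Lemma trace_local h h' x : (forall i j, h i j x = h' i j x) ->
  trace_g G h x = trace_g G h' x.
Proof.
by move=> E; apply: eq_bigr => i _; apply: eq_bigr => j _; rewrite E.
Qed.

Lemma hessian_local u v i j x : eq_on U u v -> U x ->
  hessian G u i j x = hessian G v i j x.
Proof. by move=> E; apply: cov1_local => k; exact: partial_local. Qed.

Lemma laplacian_local u v x : eq_on U u v -> U x ->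
  laplacian G u x = laplacian G v x.
Proof. by move=> E Ux; apply: trace_local => i j; exact: hessian_local. Qed.

Lemma rough_laplacian_local h h' i j x :
  (forall i j, eq_on U (h i j) (h' i j)) -> U x ->
  rough_laplacian G h i j x = rough_laplacian G h' i j x.
Proof.
move=> E Ux; apply: eq_bigr => k _; apply: eq_bigr => l _; congr (_ * _).
by apply: cov3_local Ux => b c d y; exact: cov2_local.
Qed.

Lemma delta1_local w w' x : (forall i, eq_on U (w i) (w' i)) -> U x ->
  delta1 G w x = delta1 G w' x.
Proof.
by move=> E Ux; congr (- _); apply: trace_local => i j; exact: cov1_local.
Qed.

Lemma delta2_local h h' j x : (forall i j, eq_on U (h i j) (h' i j)) -> U x ->
  delta2 G h j x = delta2 G h' j x.
Proof.
move=> E Ux; congr (- _); apply: eq_bigr => i _; apply: eq_bigr => k _.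
by congr (_ * _); exact: cov2_local.
Qed.

Lemma delta_star_local w w' i j x : (forall i, eq_on U (w i) (w' i)) -> U x ->
  delta_star G w i j x = delta_star G w' i j x.
Proof. by move=> E Ux; congr (_ * (_ + _)); exact: cov1_local. Qed.

Lemma partialZ (c : R) u k x : smooth_on U u -> U x ->
  partial k (fun y => c * u y) x = c * partial k u x.
Proof.
move=> su Ux; have dc := @smooth_diff _ _ U (fun=> c) x Ux (smooth_cst openU c).
by rewrite (partialM k dc (smooth_diff Ux su)) partial_cst mul0r add0r.
Qed.

Lemma cov1Z (c : R) w k i x : (forall i, smooth_on U (w i)) -> U x ->
  cov1 G (fun i y => c * w i y) k i x = c * cov1 G w k i x.
Proof.
move=> sw Ux; rewrite /cov1 partialZ // mulrBr mulr_sumr; congr (_ - _).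
by apply: eq_bigr => m _; rewrite mulrCA.
Qed.

Lemma trace_gZ (c : R) h x : trace_g G (fun i j y => c * h i j y) x = c * trace_g G h x.
Proof.
rewrite mulr_sumr; apply: eq_bigr => i _; rewrite mulr_sumr.
by apply: eq_bigr => j _; rewrite mulrCA.
Qed.

Lemma hessianZ (c : R) u i j x : smooth_on U u -> U x ->
  hessian G (fun y => c * u y) i j x = c * hessian G u i j x.
Proof.
move=> su Ux; rewrite /hessian -cov1Z //; last by move=> k; exact: smooth_partial.
by apply: cov1_local Ux => k y Uy; exact: partialZ.
Qed.

Lemma laplacianZ (c : R) u x : smooth_on U u -> U x ->
  laplacian G (fun y => c * u y) x = c * laplacian G u x.
Proof.
move=> su Ux; rewrite /laplacian -trace_gZ.
by apply: trace_local => i j; exact: hessianZ.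
Qed.

(** Second derivatives commute and the connection is torsion free. *)
Lemma hessian_sym u i j x : smooth_on U u -> U x ->
  hessian G u i j x = hessian G u j i x.
Proof.
move=> su Ux.
apply: etrans (congr1 (fun t => t - _) (partialC openU i j su Ux)) _.
apply: (congr1 (fun t => _ - t)); apply: eq_bigr => m _.
by rewrite (christoffel_sym gU).
Qed.

Lemma cov2M u h k i j x : smooth_on U u -> smooth2 U h -> U x ->
  cov2 G (fun i j y => u y * h i j y) k i j x =
  partial k u x * h i j x + u x * cov2 G h k i j x.
Proof.
move=> su sh Ux; rewrite /cov2.
rewrite (partialM k (smooth_diff Ux su) (smooth_diff Ux (sh i j))).
rewrite !mulrBr !addrA !mulr_sumr.
by congr (_ - _ - _); apply: eq_bigr => m _; rewrite mulrCA.
Qed.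

Lemma cov2_lower k i j x : U x -> cov2 G (lower_g G) k i j x = 0.
Proof.
move=> Ux; transitivity (tensor2_mx (cov2 G (lower_g G) k) x i j).
  by rewrite mxE.
have E y : tensor2_mx (lower_g G) y = G y by apply/matrixP => r s; rewrite mxE.
rewrite cov2_mx E (funext E) (partial_metric gU) //.
by rewrite addrAC addrK subrr mxE.
Qed.

Lemma cov2M_lower u k i j x : smooth_on U u -> U x ->
  cov2 G (fun i j y => u y * lower_g G i j y) k i j x = partial k u x * lower_g G i j x.
Proof.
move=> su Ux; rewrite cov2M // ?cov2_lower ?mulr0 ?addr0 //.
exact: smooth_lower gU.
Qed.

Lemma cov3_slot T k a i j x :
  cov3 G T k a i j x = cov2 G (T a) k i j x - \sum_m christoffel G m k a x * T m i j x.
Proof.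
by rewrite /cov3 /cov2 [X in X - _ = _]addrAC [LHS]addrAC.
Qed.

Lemma rough_laplacianM_lower u i j x : smooth_on U u -> U x ->
  rough_laplacian G (fun i j y => u y * lower_g G i j y) i j x =
  laplacian G u x * lower_g G i j x.
Proof.
move=> su Ux; rewrite mulr_suml; apply: eq_bigr => k _; rewrite mulr_suml.
apply: eq_bigr => l _; rewrite -mulrA; congr (_ * _).
rewrite (@cov3_local _ (fun a i j y => partial a u y * lower_g G i j y)) //.
  rewrite cov3_slot cov2M_lower //; last exact: smooth_partial.
  rewrite mulrBl; congr (_ - _); rewrite mulr_suml.
  by apply: eq_bigr => m _; rewrite mulrA.
by move=> b c d y Uy; exact: cov2M_lower.
Qed.

Lemma delta2M_lower u j x : smooth_on U u -> U x ->
  delta2 G (fun i j y => u y * lower_g G i j y) j x = - partial j u x.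
Proof.
move=> su Ux; congr (- _).
transitivity (\sum_i partial i u x * (i == j)%:R).
  apply: eq_bigr => i _; rewrite -(upper_lower gU i j Ux) mulr_sumr.
  by apply: eq_bigr => k _; rewrite cov2M_lower // mulrCA.
rewrite (bigD1 j) //= eqxx mulr1 big1 ?addr0 // => i /negPf ->.
by rewrite mulr0.
Qed.

(** [partial_trace] for a tensor with one further index, whose Christoffel term
    is carried along by both sides. *)
Lemma trace_cov3 T k a x : (forall a, smooth2 U (T a)) -> U x ->
  \sum_i \sum_j upper_g G i j x * cov3 G T k a i j x =
  cov1 G (fun a => trace_g G (T a)) k a x.
Proof.
move=> sT Ux; rewrite /cov1 (partial_trace gU k (sT a) Ux).
rewrite /trace_g; under eq_bigr => i _ do under eq_bigr => j _ do
  rewrite cov3_slot mulrBr.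
under eq_bigr => i _ do rewrite sumrB.
rewrite sumrB; congr (_ - _).
under [RHS]eq_bigr => m _ do (rewrite mulr_sumr;
  under eq_bigr => i _ do rewrite mulr_sumr).
rewrite [RHS]exchange_big /=; apply: eq_bigr => i _.
rewrite [RHS]exchange_big /=; apply: eq_bigr => j _.
by rewrite mulr_sumr; apply: eq_bigr => m _; rewrite mulrCA.
Qed.

Lemma smooth_cov2 h k : smooth2 U h -> smooth2 U (cov2 G h k).
Proof.
move=> sh i j; apply: (smoothD openU); first apply: (smoothD openU).
- exact: smooth_partial.
- apply: (smoothN openU); apply: (smooth_sum openU) => m.
  by apply: (smoothM openU); [exact: smooth_christoffel gU _ _ _|].
- apply: (smoothN openU); apply: (smooth_sum openU) => m.
  by apply: (smoothM openU); [exact: smooth_christoffel gU _ _ _|].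
Qed.

Lemma trace_rough_laplacian h x : smooth2 U h -> U x ->
  trace_g G (rough_laplacian G h) x = laplacian G (trace_g G h) x.
Proof.
move=> sh Ux.
transitivity (\sum_k \sum_l upper_g G k l x *
   (\sum_i \sum_j upper_g G i j x * cov3 G (cov2 G h) k l i j x)).
  transitivity (\sum_i \sum_j \sum_k \sum_l upper_g G k l x * (upper_g G i j x *
       cov3 G (cov2 G h) k l i j x)).
    apply: eq_bigr => i _; apply: eq_bigr => j _; rewrite mulr_sumr.
    apply: eq_bigr => k _; rewrite mulr_sumr; apply: eq_bigr => l _.
    exact: mulrCA.
  under [RHS]eq_bigr => k _ do (under eq_bigr => l _ do (rewrite mulr_sumr;
     under eq_bigr => i _ do rewrite mulr_sumr)).
  under [LHS]eq_bigr => i _ do rewrite exchange_big /=.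
  rewrite exchange_big /=; apply: eq_bigr => k _.
  under [LHS]eq_bigr => i _ do rewrite exchange_big /=.
  by rewrite exchange_big.
apply: eq_bigr => k _; apply: eq_bigr => l _; congr (_ * _).
rewrite trace_cov3 //; last by move=> b; exact: smooth_cov2.
by apply: cov1_local Ux => b y Uy; rewrite (partial_trace gU b sh Uy).
Qed.

Lemma trace_delta_star w x : U x -> trace_g G (delta_star G w) x = - delta1 G w x.
Proof.
move=> Ux; rewrite opprK /trace_g.
under eq_bigr => i _ do under eq_bigr => j _ do rewrite mulrCA mulrDr.
under eq_bigr => i _ do rewrite -mulr_sumr big_split /=.
rewrite -mulr_sumr big_split /=.
set A := \sum_i \sum_j _; set B := \sum_i \sum_j _.
have -> : B = A.
  rewrite /A exchange_big /=; apply: eq_bigr => i _; apply: eq_bigr => j _.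
  by rewrite (upper_sym gU).
by field.
Qed.

Lemma trace_lower x : U x -> trace_g G (lower_g G) x = n%:R.
Proof.
move=> Ux.
transitivity (\sum_(i < n) (1 : R)); last by rewrite sumr_const card_ord.
apply: eq_bigr => i _; under eq_bigr do rewrite (lower_sym gU) //.
by rewrite (upper_lower gU) // eqxx.
Qed.


(** The inner product of 2-tensors induced by the metric, when one of them is
    symmetric. *)
Definition pairing x (A B : 'I_n -> 'I_n -> R) : R :=
  \sum_a \sum_j upper_g G a j x * \sum_i \sum_k upper_g G i k x * (A a i * B k j).

Lemma pairingE x A B : U x -> pairing x A B =
  \tr (invmx (G x) *m (\matrix_(i, j) A i j)
       *m (invmx (G x) *m (\matrix_(i, j) B i j))).
Proof.
move=> Ux; rewrite /pairing exchange_big /=; apply: eq_bigr => j _; rewrite mxE.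
transitivity (\sum_a \sum_i \sum_k
  upper_g G a j x * (upper_g G i k x * (A a i * B k j))).
  apply: eq_bigr => a _; rewrite mulr_sumr; apply: eq_bigr => i _.
  by rewrite mulr_sumr.
rewrite exchange_big /=; apply: eq_bigr => i _.
rewrite !mxE mulr_suml; apply: eq_bigr => a _.
rewrite mulr_sumr; apply: eq_bigr => k _; rewrite !mxE.
rewrite (upper_sym gU) // /upper_g; ring.
Qed.

Lemma smooth_trace h : smooth2 U h -> smooth_on U (trace_g G h).
Proof.
move=> sh; apply: (smooth_sum openU) => i; apply: (smooth_sum openU) => j.
by apply: (smoothM openU); [exact: smooth_upper gU _ _|].
Qed.

Lemma cov2_tensor w v a i k x :
  (forall i, smooth_on U (w i)) -> (forall k, smooth_on U (v k)) -> U x ->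
  cov2 G (fun i k y => w i y * v k y) a i k x =
  cov1 G w a i x * v k x + w i x * cov1 G v a k x.
Proof.
move=> sw sv Ux; rewrite /cov2 /cov1.
rewrite (partialM a (smooth_diff Ux (sw i)) (smooth_diff Ux (sv k))).
have -> : \sum_m christoffel G m a i x * (w m x * v k x) =
    (\sum_m christoffel G m a i x * w m x) * v k x.
  by rewrite mulr_suml; apply: eq_bigr => m _; exact: mulrA.
have -> : \sum_m christoffel G m a k x * (w i x * v m x) =
    w i x * \sum_m christoffel G m a k x * v m x.
  by rewrite mulr_sumr; apply: eq_bigr => m _; exact: mulrCA.
move: (\sum_m _ * w m x) (\sum_m _ * v m x) (partial a (w i) x) (partial a (v k) x).
by move=> *; ring.
Qed.

(** Leibniz rule for the contraction h(w, -) of a 2-tensor with a covector. *)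
Lemma cov1_contract w h a j x :
  (forall i, smooth_on U (w i)) -> smooth2 U h -> U x ->
  cov1 G (fun j => trace_g G (fun i k y => w i y * h k j y)) a j x =
  \sum_i \sum_k upper_g G i k x *
    (cov1 G w a i x * h k j x + w i x * cov2 G h a k j x).
Proof.
move=> sw sh Ux; rewrite {1}/cov1.
have sT m : smooth2 U (fun i k y => w i y * h k m y).
  by move=> i k; exact: smoothM.
rewrite (partial_trace gU a (sT j) Ux).
have E : \sum_m christoffel G m a j x * trace_g G (fun i k y => w i y * h k m y) x
   = \sum_i \sum_k upper_g G i k x *
        \sum_m christoffel G m a j x * (w i x * h k m x).
  under eq_bigr => m _ do (rewrite mulr_sumr;
    under eq_bigr => i _ do rewrite mulr_sumr).
  rewrite exchange_big /=; apply: eq_bigr => i _.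
  rewrite exchange_big /=; apply: eq_bigr => k _.
  by rewrite mulr_sumr; apply: eq_bigr => m _; rewrite mulrCA.
rewrite E /trace_g -sumrB; apply: eq_bigr => i _; rewrite -sumrB.
apply: eq_bigr => k _; rewrite -mulrBr; congr (_ * _).
rewrite (cov2_tensor (v := fun k => h k j)) // -addrA; congr (_ + _).
have -> : \sum_m christoffel G m a j x * (w i x * h k m x) =
  w i x * \sum_m christoffel G m a j x * h k m x.
  by rewrite mulr_sumr; apply: eq_bigr => m _; exact: mulrCA.
by rewrite -mulrBr.
Qed.

(** As h is divergence free, the divergence of u h is h(grad u, -), and in the
    second divergence only grad u gets differentiated. *)
Lemma double_divergence u h x : smooth_on U u -> smooth2 U h ->
  (forall i j y, U y -> h i j y = h j i y) ->
  (forall j y, U y -> delta2 G h j y = 0) -> U x ->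
  delta1 G (delta2 G (fun i j y => u y * h i j y)) x =
  pairing x (fun i j => hessian G u i j x) (fun i j => h i j x).
Proof.
move=> su sh hC dh Ux.
have sp i : smooth_on U (partial i u) by exact: smooth_partial.
pose V j := trace_g G (fun i k y => partial i u y * h k j y).
have sV j : smooth_on U (V j).
  by apply: smooth_trace => i k; exact: smoothM.
have dE j : eq_on U (delta2 G (fun i j y => u y * h i j y) j) (fun y => -1 * V j y).
  move=> y Uy; rewrite mulN1r.
  have -> : delta2 G (fun i j y => u y * h i j y) j y = - V j y + u y * delta2 G h j y.
    rewrite /delta2 mulrN -opprD; congr (- _).
    rewrite mulr_sumr -big_split; apply: eq_bigr => i _ /=.
    rewrite mulr_sumr -big_split; apply: eq_bigr => k _ /=.
    by rewrite cov2M // mulrDr [u y * (_ * _)]mulrCA.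
  by rewrite dh // mulr0 addr0.
rewrite (delta1_local dE Ux) /delta1.
have cE i j : cov1 G (fun j y => -1 * V j y) i j x = -1 * cov1 G V i j x.
  exact: cov1Z.
rewrite (trace_local (h' := fun i j y => -1 * cov1 G V i j y) cE) trace_gZ mulN1r opprK.
transitivity (pairing x (fun i j => hessian G u i j x) (fun i j => h i j x) +
  \sum_i \sum_k upper_g G i k x * (partial i u x *
     \sum_a \sum_j upper_g G a j x * cov2 G h a k j x)).
  have -> : \sum_i \sum_k upper_g G i k x * (partial i u x *
     \sum_a \sum_j upper_g G a j x * cov2 G h a k j x) =
    \sum_a \sum_j upper_g G a j x *
      \sum_i \sum_k upper_g G i k x * (partial i u x * cov2 G h a k j x).
    under eq_bigr => i _ do under eq_bigr => k _ do (rewrite mulrA mulr_sumr;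
      under eq_bigr => a _ do rewrite mulr_sumr).
    under [RHS]eq_bigr => a _ do under eq_bigr => j _ do (rewrite mulr_sumr;
      under eq_bigr => i _ do rewrite mulr_sumr).
    under [LHS]eq_bigr => i _ do rewrite exchange_big /=.
    rewrite exchange_big /=; apply: eq_bigr => a _.
    rewrite [RHS]exchange_big /=; apply: eq_bigr => i _.
    rewrite exchange_big /=; apply: eq_bigr => j _.
    by apply: eq_bigr => k _; ring.
  rewrite /pairing -big_split; apply: eq_bigr => a _.
  rewrite -big_split; apply: eq_bigr => j _ /=; rewrite -mulrDr; congr (_ * _).
  rewrite cov1_contract // -big_split; apply: eq_bigr => i _ /=.
  by rewrite -big_split; apply: eq_bigr => k _ /=; rewrite -mulrDr.
rewrite [X in _ + X]big1 ?addr0 // => i _; rewrite big1 // => k _.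
have -> : \sum_a \sum_j upper_g G a j x * cov2 G h a k j x = - delta2 G h k x.
  rewrite opprK; apply: eq_bigr => a _; apply: eq_bigr => j _; apply: congr1.
  exact: (cov2_sym gU).
by rewrite dh // oppr0 !mulr0.
Qed.

Lemma curv_actionE h i j x : U x -> curv_action G h i j x =
  \sum_k \sum_l \sum_t upper_g G k l x * (curvature G k i x j t * h l t x).
Proof.
move=> Ux; apply: eq_bigr => k _; apply: eq_bigr => l _.
rewrite exchange_big /=; apply: eq_bigr => t _.
rewrite -riemann_upE -(raise_lower gU (fun m => riemann_up G k i j m x) t Ux).
rewrite mulr_suml mulr_sumr; apply: eq_bigr => s _.
rewrite (upper_sym gU s t Ux) -/(riemann G k i j s x).
by rewrite -!mulrA.
Qed.

Lemma curv_action_lower i j x : U x ->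
  curv_action G (lower_g G) i j x = ricci G i j x.
Proof.
move=> Ux; rewrite curv_actionE // (ricciE gU) //; apply: eq_bigr => k _.
transitivity (\sum_l upper_g G k l x *
  (\sum_t lower_g G l t x * curvature G k i x j t)).
  apply: eq_bigr => l _; rewrite mulr_sumr; apply: eq_bigr => t _; congr (_ * _).
  exact: mulrC.
exact: (raise_lower gU).
Qed.

(** By the antisymmetry of the Riemann tensor in its first and in its last pair of
    indices, contracting the two middle indices also gives the Ricci tensor. *)
Lemma trace_curv_action h x : U x ->
  trace_g G (curv_action G h) x =
  pairing x (fun i j => h i j x) (fun i j => ricci G i j x).
Proof.
move=> Ux.
transitivity (\sum_k \sum_l \sum_t (upper_g G k l x * h l t x) *
  \sum_i \sum_j upper_g G i j x * curvature G k i x j t).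
  transitivity (\sum_i \sum_j \sum_k \sum_l \sum_t (upper_g G k l x * h l t x) *
     (upper_g G i j x * curvature G k i x j t)).
    apply: eq_bigr => i _; apply: eq_bigr => j _; rewrite curv_actionE // mulr_sumr.
    apply: eq_bigr => k _; rewrite mulr_sumr; apply: eq_bigr => l _.
    rewrite mulr_sumr; apply: eq_bigr => t _; ring.
  under [LHS]eq_bigr => i _ do rewrite exchange_big /=.
  rewrite exchange_big /=; apply: eq_bigr => k _.
  under [LHS]eq_bigr => i _ do rewrite exchange_big /=.
  rewrite exchange_big /=; apply: eq_bigr => l _.
  under [LHS]eq_bigr => i _ do rewrite exchange_big /=.
  rewrite exchange_big /=; apply: eq_bigr => t _.
  by rewrite mulr_sumr; apply: eq_bigr => i _; rewrite mulr_sumr.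
have E k t : \sum_i \sum_j upper_g G i j x * curvature G k i x j t =
    \sum_j upper_g G t j x * ricci G j k x.
  under eq_bigr => i _ do
    rewrite (raise_skew gU i t Ux (curvature_skew gU k i Ux)) -sumrN.
  rewrite exchange_big /=; apply: eq_bigr => j _.
  rewrite (ricci_sym gU) // (ricciE gU) // mulr_sumr; apply: eq_bigr => i _.
  by rewrite curvature_antisym oppmxE mulrN opprK.
rewrite exchange_big /=; apply: eq_bigr => l _; apply: eq_bigr => k _.
rewrite mulr_sumr; apply: eq_bigr => t _.
rewrite E !mulr_sumr; apply: eq_bigr => j _.
rewrite (upper_sym gU k l Ux); ring.
Qed.

End TensorCalculus.

(** * Positive definite matrices *)

Section PositiveDefinite.
Context (R : rcfType).

Definition posdef n (C : 'M[R]_n) :=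
  forall v : 'rV[R]_n, v != 0 -> 0 < (v *m C *m v^T) 0 0.

Lemma posdef_unit n (C : 'M[R]_n) : posdef C -> C \in unitmx.
Proof.
move=> pC; rewrite -row_free_unit -kermx_eq0; apply/eqP/row_matrixP => i.
rewrite row0; apply/eqP; apply: contraT => /pC.
have /sub_kermxP -> : (row i (kermx C) <= kermx C)%MS by exact: row_sub.
by rewrite mul0mx mxE ltxx.
Qed.

Lemma posdef_inv n (C : 'M[R]_n) : C^T = C -> posdef C -> posdef (invmx C).
Proof.
move=> symC pC v v0; have uC := posdef_unit pC.
have w0 : v *m invmx C != 0.
  by apply: contra v0 => /eqP E; rewrite -[v](mulmxKV uC) E mul0mx.
have := pC _ w0; rewrite trmx_mul trmx_inv symC mulmxKV //.
by rewrite mulmxA.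
Qed.

(** Induction on the size: with corner entry c and first row b, the Schur complement
    S = D - b^T b / c is again positive definite, and a factor L of S is completed
    by the row (sqrt c, b / sqrt c). *)
Lemma cholesky n (C : 'M[R]_n) : C^T = C -> posdef C ->
  exists L : 'M[R]_n, C = L^T *m L.
Proof.
elim: n C => [|n IH] C; first by exists 0; apply/matrixP => -[].
rewrite -[n.+1]/(1 + n)%N in C *.
rewrite -[C]submxK.
set a := ulsubmx C; set b := ursubmx C; set b' := dlsubmx C; set D := drsubmx C.
rewrite tr_block_mx => /eq_block_mx [aT b'T _ DT] pC.
have a0 : 0 < a 0 0.
  have v0 : row_mx 1%:M (0 : 'rV[R]_n) != 0.
    apply/eqP => /matrixP/(_ 0 (lshift n 0)); rewrite row_mxEl !mxE.
    by move/eqP; rewrite oner_eq0.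
  have := pC _ v0; rewrite mul_row_block tr_row_mx mul_row_col.
  by rewrite trmx1 trmx0 !mulmx1 !mul1mx !mul0mx mulmx0 !addr0.
have aE : a = (a 0 0)%:M by exact: mx11_scalar.
set c := a 0 0 in a0 aE.
have b'E : b' = b^T by rewrite -b'T trmxK.
pose S := D - c^-1 *: (b^T *m b).
have symS : S^T = S by rewrite /S raddfB /= linearZ /= trmx_mul trmxK DT.
have pS : posdef S.
  move=> w w0.
  (* with this first coordinate the form of C at (s, w) is that of S at w *)
  pose s := - c^-1 *: (w *m b^T).
  have v0 : row_mx s w != 0.
    apply: contra w0 => /eqP E; rewrite -(row_mxKr s w) E.
    by apply/eqP/matrixP => i j; rewrite !mxE.
  have := pC _ v0; rewrite mul_row_block tr_row_mx mul_row_col.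
  have -> : s *m a + w *m b' = 0.
    rewrite aE b'E mul_mx_scalar /s scalerA mulrN divff ?gt_eqF // scaleN1r.
    by rewrite addNr.
  rewrite mul0mx add0r; congr (0 < (_ *m _) 0 0).
  rewrite /s /S mulmxBr addrC; congr (_ + _).
  by rewrite scaleNr mulNmx -scalemxAl -scalemxAr mulmxA.
have [L LE] := IH S symS pS.
pose q := Num.sqrt c.
have qq : q * q = c by rewrite -expr2 sqr_sqrtr // ltW.
have q0 : q != 0 by rewrite gt_eqF // sqrtr_gt0.
exists (block_mx q%:M (q^-1 *: b) 0 L).
have bT : (q^-1 *: b)^T = q^-1 *: b^T by rewrite linearZ.
rewrite tr_block_mx mulmx_block !trmx0 tr_scalar_mx bT.
rewrite !mulmx0 !mul0mx !addr0 -scalar_mxM qq -aE.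
congr (block_mx _ _ _ _).
- by rewrite mul_scalar_mx scalerA divff // scale1r.
- by rewrite mul_mx_scalar scalerA divff // scale1r b'E.
- rewrite -LE /S -scalemxAl -scalemxAr scalerA -invfM qq.
  by rewrite addrC subrK.
Qed.

(** If C = L^T L, the trace is the sum of the squares of the entries of the
    symmetric matrix L B L^T. *)
Lemma posdef_pairing n (C B : 'M[R]_n) : C^T = C -> posdef C -> B^T = B ->
  \tr (C *m B *m (C *m B)) = 0 -> B = 0.
Proof.
move=> symC pC symB; have [L CE] := cholesky symC pC.
have uL : L \in unitmx.
  by have := posdef_unit pC; rewrite CE unitmx_mul => /andP[].
have uLt : L^T \in unitmx by rewrite unitmx_tr.
set N := L *m B *m L^T.
have symN : N^T = N by rewrite /N !trmx_mul trmxK symB mulmxA.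
have -> : \tr (C *m B *m (C *m B)) = \tr (N *m N^T).
  by rewrite symN CE /N -!mulmxA mxtrace_mulC !mulmxA.
rewrite mxtrace_mul_tr => tr0.
have N0 : N = 0.
  apply/matrixP => i j; rewrite [RHS]mxE.
  have ge0 k l : 0 <= N k l * N k l by rewrite -expr2 sqr_ge0.
  have rowE : \sum_l N i l * N i l = 0.
    by apply: (psumr_eq0P _ tr0) => // l _; apply: sumr_ge0 => m _; exact: ge0.
  have /eqP : N i j * N i j = 0 by apply: (psumr_eq0P _ rowE) => // l _; exact: ge0.
  by rewrite mulf_eq0 orbb => /eqP.
by rewrite -[B](mulKmx uL) -[L *m B](mulmxK uLt) -/N N0 mul0mx mulmx0.
Qed.

End PositiveDefinite.

(** * The critical point equation in a chart *)

Section CriticalPoint.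
Context (R : realType) (n : nat) (U : set 'rV[R]_n) (G : 'rV[R]_n -> 'M[R]_n).
Context (gU : metric_on U G) (posG : forall x, U x -> posdef (G x)).
Context (u : 'rV[R]_n -> R) (k : R).
Context (n3 : (3 <= n)%N) (su : smooth_on U u)
  (scalk : forall x, U x -> scalar_curvature G x = k).
Context (cpe : forall x, U x -> forall i j,
  hessian G u i j x - laplacian G u x * lower_g G i j x - u x * ricci G i j x
  = traceless_ricci G i j x).
Let openU : open U := metric_on_open gU.
Implicit Types (x : 'rV[R]_n) (i j l m a : 'I_n).

Let n0 : n%:R != 0 :> R.
Proof. by rewrite pnatr_eq0; case: n n3. Qed.

Let n1 : n%:R - 1 != 0 :> R.
Proof. by rewrite subr_eq0 pnatr_eq1; case: n n3 => [|[]]. Qed.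

(** With Ric = lam g and g parallel, Lambda^*(u) is
    (lam - n k / (4 (n - 1))) ((Delta u) g - Hess u + u lam g), and the second
    factor is minus the left-hand side of the critical point equation. *)
Lemma einstein_in_kernel :
  (forall x, U x -> forall i j, traceless_ricci G i j x = 0) ->
  forall x, U x -> forall i j, Lambda_star_coord G u i j x = 0.
Proof.
move=> ein x Ux i j.
pose lam := k / n%:R.
have ricE y a b : U y -> ricci G a b y = lam * lower_g G a b y.
  move=> Uy; have := ein y Uy a b; rewrite /traceless_ricci (scalk Uy) => /eqP.
  by rewrite subr_eq0 => /eqP.
pose v y := lam * u y.
have sv : smooth_on U v by apply: (smoothM openU) => //; exact: smooth_cst.
have uricE a b : eq_on U (fun y => u y * ricci G a b y)
    (fun y => v y * lower_g G a b y).
  by move=> y Uy; rewrite ricE // /v mulrCA mulrA.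
have uscalE : eq_on U (fun y => u y * scalar_curvature G y) (fun y => k * u y).
  by move=> y Uy; rewrite scalk // mulrC.
rewrite /Lambda_star_coord.
have -> : rough_laplacian G (fun a b y => u y * ricci G a b y) i j x =
    lam * laplacian G u x * lower_g G i j x.
  rewrite (rough_laplacian_local gU i j uricE Ux) (rough_laplacianM_lower gU) //.
  by rewrite (laplacianZ gU).
have dE a : eq_on U (delta2 G (fun a b y => u y * ricci G a b y) a)
    (fun y => - lam * partial a u y).
  move=> y Uy; rewrite (delta2_local gU a uricE Uy) (delta2M_lower gU) //.
  by rewrite (partialZ gU) // mulNr.
have sp a : smooth_on U (partial a u) by exact: smooth_partial.
have -> : delta1 G (delta2 G (fun a b y => u y * ricci G a b y)) x =
    lam * laplacian G u x.
  rewrite (delta1_local gU dE Ux) /delta1.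
  rewrite (@trace_local _ _ _ _ (fun a b y => - lam * hessian G u a b y)).
    by rewrite trace_gZ mulNr opprK.
  by move=> a b; exact: (cov1Z gU).
have -> : delta_star G (delta2 G (fun a b y => u y * ricci G a b y)) i j x =
    - lam * hessian G u i j x.
  rewrite (delta_star_local gU i j dE Ux) /delta_star !(cov1Z gU) // -/(hessian G u).
  by rewrite (hessian_sym gU j i su Ux); field.
have -> : curv_action G (ricci G) i j x = lam * (lam * lower_g G i j x).
  rewrite -(ricE x) // -(curv_action_lower gU) // !(curv_actionE gU) // mulr_sumr.
  apply: eq_bigr => a _; rewrite mulr_sumr; apply: eq_bigr => b _; rewrite mulr_sumr.
  by apply: eq_bigr => c _; rewrite ricE //; ring.
rewrite (laplacian_local gU uscalE Ux) (laplacianZ gU) //.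
rewrite (hessian_local gU i j uscalE Ux) (hessianZ gU) //.
have := cpe Ux i j; rewrite (ein x Ux) (scalk Ux) (ricE x) //.
move: (hessian G u i j x) (laplacian G u x) (lower_g G i j x) (u x) => H L g v0 E.
have -> : H = L * g + v0 * (lam * g) by lra.
by rewrite /lam; field; rewrite n0 n1.
Qed.

Lemma ricci_div_free j x : U x -> delta2 G (ricci G) j x = 0.
Proof.
move=> Ux; have := contracted_bianchi gU j Ux.
have -> : partial j (scalar_curvature G) x = 0.
  have E : eq_on U (scalar_curvature G) (fun=> k) by move=> y; exact: scalk.
  by rewrite (partial_local openU j E Ux) partial_cst.
by move/eqP; rewrite eq_sym mulf_eq0 oppr_eq0 pnatr_eq0 => /eqP.
Qed.

Implicit Types (h : 'I_n -> 'I_n -> 'rV[R]_n -> R).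

Let g_ x : 'M[R]_n := \matrix_(i, j) lower_g G i j x.
Let ric_ x : 'M[R]_n := \matrix_(i, j) ricci G i j x.

Lemma trace_matrix h x : U x ->
  trace_g G h x = \tr (invmx (G x) *m \matrix_(i, j) h i j x).
Proof.
move=> Ux; rewrite trace_gE -mxtrace_tr trmx_mul trmxK mxtrace_mulC.
by rewrite trmx_inv (metric_on_sym gU).
Qed.

Lemma trace_cpe x : U x -> laplacian G u x = n%:R * laplacian G u x + u x * k.
Proof.
move=> Ux.
have E : \matrix_(i, j) hessian G u i j x =
  laplacian G u x *: g_ x + u x *: ric_ x + ric_ x + (- (k / n%:R)) *: g_ x.
  apply/matrixP => i j; rewrite !(addmxE, oppmxE) !mxE.
  by have := cpe Ux i j; rewrite /traceless_ricci (scalk Ux) => H; lra.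
have trg : \tr (invmx (G x) *m g_ x) = n%:R.
  by rewrite -(trace_matrix _ Ux) (trace_lower gU).
have trr : \tr (invmx (G x) *m ric_ x) = k.
  by rewrite -(trace_matrix _ Ux); exact: scalk.
rewrite {1}/laplacian trace_matrix // E !mulmxDr -!scalemxAr.
by rewrite !mxtraceD !mxtraceZ trg trr; field.
Qed.

Lemma trace_gD h h' x : trace_g G (fun i j y => h i j y + h' i j y) x =
  trace_g G h x + trace_g G h' x.
Proof.
rewrite -big_split; apply: eq_bigr => i _; rewrite -big_split.
by apply: eq_bigr => j _; rewrite mulrDr.
Qed.

Lemma trace_gM (c : 'rV[R]_n -> R) h x :
  trace_g G (fun i j y => c y * h i j y) x = c x * trace_g G h x.
Proof. by rewrite -trace_gZ. Qed.

(** The trace commutes with the rough Laplacian, the trace of delta^* w is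
    - delta w, and the trace of the curvature action on Ric is |Ric|^2. *)
Lemma trace_Lambda_star x : U x ->
  trace_g G (Lambda_star_coord G u) x =
  2^-1 * (k * laplacian G u x)
  + (n%:R / 2 - 1) * delta1 G (delta2 G (fun i j y => u y * ricci G i j y)) x
  + u x * pairing G x (fun i j => ricci G i j x) (fun i j => ricci G i j x)
  - n%:R / (4 * (n%:R - 1)) *
    ((n%:R - 1) * (k * laplacian G u x) + u x * k ^+ 2).
Proof.
move=> Ux; pose c : R := n%:R / (4 * (n%:R - 1)).
pose h i j y := u y * ricci G i j y.
have sh : smooth2 U h by move=> i j; apply: (smoothM openU) => //; exact: smooth_ricci.
pose w y := u y * scalar_curvature G y.
have trh : trace_g G h = w by apply/funext => y; rewrite /h trace_gM.
have wE : eq_on U w (fun y => k * u y) by move=> y Uy; rewrite /w scalk // mulrC.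
have LwE : laplacian G w x = k * laplacian G u x.
  by rewrite (laplacian_local gU wE Ux) (laplacianZ gU).
have lin (F A B C D E : 'I_n -> 'I_n -> 'rV[R]_n -> R) (p q r : R) :
  (forall i j, F i j x = 2^-1 * A i j x + p * lower_g G i j x + B i j x
     + u x * C i j x + - c * (q * lower_g G i j x + -1 * D i j x + r * E i j x)) ->
  trace_g G F x =
  2^-1 * trace_g G A x + p * trace_g G (lower_g G) x + trace_g G B x
     + u x * trace_g G C x + - c * (q * trace_g G (lower_g G) x
     + -1 * trace_g G D x + r * trace_g G E x).
  move=> FE; rewrite (@trace_local _ _ _ F (fun i j y => 2^-1 * A i j y
     + p * lower_g G i j y + B i j y + u x * C i j y
     + - c * (q * lower_g G i j y + -1 * D i j y + r * E i j y)) x FE).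
  by rewrite !trace_gD !trace_gZ !trace_gD !trace_gZ.
rewrite (lin (Lambda_star_coord G u) (rough_laplacian G h) (delta_star G (delta2 G h))
  (curv_action G (ricci G)) (hessian G w) (ricci G)
  (2^-1 * delta1 G (delta2 G h) x) (laplacian G w x) (w x)); last first.
  by move=> i j; rewrite mulN1r mulNr.
rewrite (trace_rough_laplacian gU sh Ux) trh (trace_lower gU Ux).
rewrite (trace_delta_star gU _ Ux) (trace_curv_action gU _ Ux).
rewrite -/(laplacian G w x) LwE -/(scalar_curvature G x) /w (scalk Ux).
move: (pairing _ _ _ _) (delta1 _ _ _) (laplacian _ _ _) => q D L.
by rewrite /c; field.
Qed.

(** The second factor is |Ric0|^2.  The double divergence in [trace_Lambda_star] is
    <Hess u, Ric>, and the critical point equation turns it into an expression in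
    |Ric|^2, Delta u and u; the traced equation u k = (1 - n) Delta u then
    eliminates Delta u. *)
Lemma kernel_identity x : U x ->
  (forall i j, Lambda_star_coord G u i j x = 0) ->
  (n%:R * u x + n%:R - 2) *
  (pairing G x (fun i j => ricci G i j x) (fun i j => ricci G i j x)
   - k ^+ 2 / n%:R) = 0.
Proof.
move=> Ux ker.
have T0 : trace_g G (Lambda_star_coord G u) x = 0.
  by apply: big1 => i _; apply: big1 => j _; rewrite ker mulr0.
rewrite (trace_Lambda_star Ux) in T0.
have := trace_cpe Ux.
rewrite (double_divergence gU su (smooth_ricci gU)
  (fun i j => @ricci_sym _ _ _ _ gU i j) ricci_div_free Ux) in T0.
have E : pairing G x (fun i j => hessian G u i j x) (fun i j => ricci G i j x) =
  laplacian G u x * k + (u x + 1) *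
  pairing G x (fun i j => ricci G i j x) (fun i j => ricci G i j x) - k ^+ 2 / n%:R.
  rewrite !(pairingE gU) // -/(ric_ x).
  have -> : \matrix_(i, j) hessian G u i j x =
    (laplacian G u x - k / n%:R) *: G x + (u x + 1) *: ric_ x.
    apply/matrixP => i j; rewrite addmxE !mxE -/(lower_g G i j x).
    by have := cpe Ux i j; rewrite /traceless_ricci (scalk Ux) => H; lra.
  have uG := metric_on_unit gU Ux.
  have trr : \tr (invmx (G x) *m ric_ x) = k.
  by rewrite -(trace_matrix _ Ux); exact: scalk.
  rewrite mulmxDr -!scalemxAr mulVmx // mulmxDl mxtraceD -!scalemxAl !mxtraceZ.
  by rewrite mul1mx trr; field.
rewrite E in T0; move: T0.
move: (pairing _ _ _ _) (laplacian _ _ _) (u x) => q L v T0 LE.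
have vk : v * k = (1 - n%:R) * L by rewrite mulrBl mul1r {1}LE; ring.
have vkk : v * k ^+ 2 = - ((n%:R - 1) * (k * L)).
  by rewrite expr2 mulrA vk; ring.
rewrite vkk subrr mulr0 subr0 in T0.
have -> : (n%:R * v + n%:R - 2) * (q - k ^+ 2 / n%:R) =
  2 * (2^-1 * (k * L) + (n%:R / 2 - 1) * (L * k + (v + 1) * q - k ^+ 2 / n%:R) + v * q)
  - (v * k ^+ 2 + (n%:R - 1) * (k * L)) by field.
by rewrite T0 vkk addNr mulr0 subr0.
Qed.

(** |Ric|^2 - k^2/n is the squared norm of B = Ric - (k/n) g, and the metric is
    definite on symmetric 2-tensors. *)
Lemma traceless_or_potential x : U x ->
  (forall i j, Lambda_star_coord G u i j x = 0) ->
  (forall i j, traceless_ricci G i j x = 0) \/ n%:R * u x + n%:R - 2 = 0.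
Proof.
move=> Ux /(kernel_identity Ux)/eqP; rewrite mulf_eq0 => /orP[/eqP|/eqP E0].
  by right.
left; pose B := ric_ x - (k / n%:R) *: G x.
have uG := metric_on_unit gU Ux; have symG := metric_on_sym gU Ux.
have trr : \tr (invmx (G x) *m ric_ x) = k.
  by rewrite -(trace_matrix _ Ux); exact: scalk.
have symI : (invmx (G x))^T = invmx (G x) by rewrite trmx_inv symG.
have symB : B^T = B.
  rewrite /B raddfB /= linearZ /= symG; congr (_ - _).
  by apply/matrixP => i j; rewrite !mxE (ricci_sym gU).
have trB : \tr (invmx (G x) *m B *m (invmx (G x) *m B)) = 0.
  rewrite -[RHS]E0 (pairingE gU) // -/(ric_ x).
  have -> : invmx (G x) *m B = invmx (G x) *m ric_ x - (k / n%:R)%:M.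
    by rewrite mulmxBr -scalemxAr mulVmx // scalemx1.
  rewrite mulmxBl !mulmxBr !mul_mx_scalar !mul_scalar_mx !raddfB /= !mxtraceZ.
  by rewrite mxtrace_scalar trr -mulr_natr; field.
have B0 := posdef_pairing symI (posdef_inv symG (posG Ux)) symB trB.
move=> i j; have /matrixP/(_ i j) := B0; rewrite /B !mxE => E.
by rewrite /traceless_ricci (scalk Ux).
Qed.

(** Near a point where Ric0 does not vanish, [traceless_or_potential] makes u
    constant, and the critical point equation with Hess u = 0 forces Ric = 0. *)
Lemma kernel_einstein :
  (forall x, U x -> forall i j, Lambda_star_coord G u i j x = 0) ->
  forall x, U x -> forall i j, traceless_ricci G i j x = 0.
Proof.
move=> ker x Ux i j; apply: contrapT => /eqP P0.
(* the root of n c + n - 2 *)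
pose c : R := (2 - n%:R) / n%:R.
have sT : smooth_on U (traceless_ricci G i j).
  have sr := smooth_ricci gU i j.
  have sl := smooth_lower gU i j.
  have sk : smooth_on U (fun y => - (k / n%:R * lower_g G i j y)).
    by apply: (smoothN openU); apply: (smoothM openU) => //; exact: smooth_cst.
  apply: (smooth_local openU _ (smoothD openU sr sk)) => y Uy.
  by rewrite /traceless_ricci scalk.
pose W := U `&` [set y | traceless_ricci G i j y != 0].
have cT : {for x, continuous (traceless_ricci G i j)}.
  by apply: differentiable_continuous; exact: smooth_diff sT.
have nW : nbhs x W.
  apply: filterI; first exact: open_nbhs_nbhs.
  have nN : nbhs (traceless_ricci G i j x) [set t | t != 0].
    by apply: open_nbhs_nbhs; split; [exact: open_neq|].
  exact: cT nN.
pose V := W°.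
have oV : open V by exact: open_interior.
have Vx : V x by [].
have VU y : V y -> U y by move=> /interior_subset[].
have uc : eq_on V u (fun=> c).
  move=> y /interior_subset[Uy Py].
  have [T0|E] := traceless_or_potential Uy (ker y Uy).
    by move: Py => /=; rewrite T0 eqxx.
  have nu : n%:R * u y = 2 - n%:R by lra.
  by rewrite /c -nu mulrC mulKf.
have du a : eq_on V (partial a u) (fun=> 0).
  by move=> y Vy; rewrite (partial_local oV a uc Vy) partial_cst.
have H0 a b : hessian G u a b x = 0.
  rewrite /hessian /cov1 (partial_local oV a (du b) Vx) partial_cst sub0r.
  by rewrite big1 ?oppr0 // => m _; rewrite du // mulr0.
have L0 : laplacian G u x = 0.
  by apply: big1 => a _; apply: big1 => b _; rewrite H0 mulr0.
have ux : u x = c by exact: uc.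
have n3R : 3 <= n%:R :> R by rewrite (ler_nat R 3 n).
have c0 : c != 0 by rewrite mulf_neq0 ?invr_eq0 // subr_eq0 lt_eqF //; lra.
have k0 : k = 0.
  have := trace_cpe Ux; rewrite L0 mulr0 add0r ux => /esym/eqP.
  by rewrite mulf_eq0 (negPf c0) => /eqP.
have := cpe Ux i j; move: P0; rewrite /traceless_ricci (scalk Ux) k0 mul0r.
rewrite !mul0r subr0 H0 L0 mul0r subr0 sub0r ux => P0 E.
have : (1 + c) * ricci G i j x = 0 by rewrite mulrDl mul1r -{1}E addNr.
have -> : 1 + c = 2 / n%:R by rewrite /c; field.
by apply/eqP; rewrite !mulf_neq0 // ?invr_eq0 // pnatr_eq0.
Qed.

End CriticalPoint.

(** * Completeness of compact manifolds *)

(** The integral of a nonnegative function is the supremum of the integrals of the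
    simple functions below it. *)
Lemma ge0_le_integral_pointwise d (T : measurableType d) (R : realType)
    (mu : {measure set T -> \bar R}) (D : set T) (f1 f2 : T -> \bar R) :
  (forall x, D x -> 0 <= f1 x)%E -> (forall x, D x -> f1 x <= f2 x)%E ->
  (\int[mu]_(x in D) f1 x <= \int[mu]_(x in D) f2 x)%E.
Proof.
move=> f10 f12; have f20 x : D x -> (0 <= f2 x)%E.
  by move=> Dx; exact: le_trans (f10 x Dx) (f12 x Dx).
rewrite !ge0_integralE //; apply: ereal_sup_le => _ [h /= hf <-].
exists h => //= x; apply: le_trans (hf x) _.
by apply: lee_restrict.
Qed.

Lemma continuous_near_eq (V W : topologicalType) (F H : V -> W) (t : V) :
  (\near t, F t = H t) -> {for t, continuous F} -> {for t, continuous H}.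
Proof.
move=> FH cF; rewrite /prop_for /continuous_at -(nbhs_singleton FH).
by apply: cvg_trans cF; apply: near_eq_cvg; apply: filterS FH.
Qed.

Section MatrixValued.
Context (R : realType) (n : nat).

Lemma continuous_rV (F : R -> 'rV[R]_n) (t : R) :
  (forall j, {for t, continuous (fun s => F s 0 j)}) -> {for t, continuous F}.
Proof.
move=> cF; apply/cvgrPdist_lt => /= e e0.
have : \forall s \near t, forall j, `|F t 0 j - F s 0 j| < e.
  apply: (@filter_forall _ _ (fun j s => `|F t 0 j - F s 0 j| < e) _ (nbhs_filter t)).
  by move=> j; have /cvgrPdist_lt/(_ _ e0) := cF j.
apply: filterS => s sP.
rewrite /Num.Def.normr /= mx_normrE; apply/bigmax_ltP; split => // -[i j] _ /=.
by rewrite !mxE ord1; exact: sP.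
Qed.

Lemma differentiable_rV (V : normedModType R) (F : V -> 'rV[R]_n) (x : V) :
  (forall j, differentiable (fun y => F y 0 j) x) -> differentiable F x.
Proof.
move=> dF.
have -> : F = \sum_(j < n) (fun y => F y 0 j *: (delta_mx 0 j : 'rV[R]_n)).
  apply/funext => y; rewrite fct_sumE [LHS]row_sum_delta.
  by apply: eq_bigr.
by apply: differentiable_sum => j; exact: differentiableZl.
Qed.

Lemma quadratic_form_bound (A : 'M[R]_n) (v : 'rV[R]_n) (K : R) :
  (forall i j, `|A i j| <= K) ->
  (v *m A *m v^T) 0 0 <= (n * n)%:R * K * `|v| ^+ 2.
Proof.
move=> AK.
have vE j : `|v 0 j| <= `|v|.
  by rewrite [leRHS]/Num.Def.normr /= mx_normrE; exact: (le_bigmax _ _ (0, j)).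
rewrite mxE; apply: (@le_trans _ _ (\sum_(j < n) n%:R * K * `|v| ^+ 2)).
  apply: ler_sum => j _; rewrite !mxE mulr_suml.
  apply: (@le_trans _ _ (\sum_(i < n) K * `|v| ^+ 2)).
    apply: ler_sum => i _; apply: le_trans (ler_norm _) _.
    rewrite !normrM mulrAC mulrC expr2; apply: ler_pM => //.
    by apply: ler_pM.
  by rewrite sumr_const card_ord -[leLHS]mulr_natl mulrA lexx.
by rewrite sumr_const card_ord natrM -[leLHS]mulr_natl !mulrA lexx.
Qed.

End MatrixValued.

Lemma jacobian_partial (R : realType) (n : nat) (F : 'rV[R]_n -> 'rV[R]_n)
    (x : 'rV[R]_n) i j : differentiable F x ->
  jacobian F x i j = partial i (fun y => F y 0 j) x.
Proof.
move=> dF; transitivity (((delta_mx 0 i : 'rV[R]_n) *m jacobian F x) 0 j).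
  by rewrite -rowE [RHS]mxE.
have D : derivable F x (delta_mx 0 i : 'rV[R]_n) by exact: diff_derivable.
by rewrite -deriveEjacobian // derive_mx // mxE.
Qed.

Section Paths.
#[local] Notation coord := Defs.coord.
Context (R : realType) (n : nat) (M : ptopologicalType)
  (S : smooth_structure R n M) (g : riemannian_metric S).
Implicit Types (c : chart R n M) (x y v : 'rV[R]_n).

Lemma overlap_nbhs c c' x : overlap c c' x -> nbhs x (overlap c c').
Proof.
move=> [cx dx]; apply: filterI.
  by apply: open_nbhs_nbhs; split => //; exact: cod_open.
apply: (param_continuous cx); apply: open_nbhs_nbhs; split => //.
exact: dom_open.
Qed.

Lemma differentiable_transition c c' x : atlas S c -> atlas S c' ->
  overlap c c' x -> differentiable (transition c c') x.
Proof.
move=> ac ac' ox; apply: differentiable_rV => j.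
exact: (transition_smooth ac ac' j [::]).
Qed.

Lemma is_derive_transition_line c c' y v t : atlas S c -> atlas S c' ->
  overlap c c' (y + t *: v) ->
  is_derive t 1 (coord c' \o (fun s : R => param c (y + s *: v)))
    (v *m jacobian (transition c c') (y + t *: v)).
Proof.
move=> ac ac' ot; have dT := differentiable_transition ac ac' ot.
by rewrite -deriveEjacobian //; exact: is_derive_line.
Qed.

Lemma line_nbhs (A : set 'rV[R]_n) y v (t : R) :
  nbhs (y + t *: v) A -> \forall s \near t, A (y + s *: v).
Proof.
move=> nA; have cl : {for t, continuous (fun s : R => y + s *: v)}.
  by apply: cvgD; [exact: cvg_cst|apply: cvgZ; [exact: cvg_id|exact: cvg_cst]].
exact: cl nA.
Qed.

Lemma C1_arc_line c y v : atlas S c ->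
  (forall t, 0 <= t <= 1 -> cod c (y + t *: v)) ->
  C1_arc S 0 1 (fun t => param c (y + t *: v)).
Proof.
move=> ac seg; split; first exact: ler01.
move=> t /seg ct; split.
  move=> A nA; apply: (line_nbhs (A := param c @^-1` A)).
  exact: (param_continuous ct).
move=> c' ac' dt; have ot : overlap c c' (y + t *: v) by [].
have near_o := line_nbhs (overlap_nbhs ot).
split.
  by apply: filterS near_o => s /(is_derive_transition_line ac ac')[].
pose F s := v *m jacobian (transition c c') (y + s *: v).
have dE : \forall s \near t,
    F s = derive1 (coord c' \o (fun s => param c (y + s *: v))) s.
  apply: filterS near_o => s /(is_derive_transition_line ac ac') D.
  by rewrite derive1E derive_val.
have cl : {for t, continuous (fun s : R => y + s *: v)}.
  by apply: cvgD; [exact: cvg_cst|apply: cvgZ; [exact: cvg_id|exact: cvg_cst]].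
apply: continuous_near_eq dE _; apply: continuous_rV => j.
pose H s := \sum_i v 0 i * partial i (fun x => transition c c' x 0 j) (y + s *: v).
apply: (@continuous_near_eq _ _ H).
  apply: filterS near_o => s os; rewrite /F mxE; apply: eq_bigr => i _.
  by rewrite jacobian_partial //; exact: differentiable_transition.
apply: cvg_big => [|i _]; first exact: add_continuous.
apply: cvgM; first exact: cvg_cst.
apply: continuous_comp; first exact: cl.
apply: differentiable_continuous.
exact: (transition_smooth ac ac' j [:: i]).
Qed.

(** The speed is measured in a chart that varies along the curve; the
    transformation law of the metric brings it back to the fixed chart c. *)
Lemma speed_line c y v t : atlas S c -> cod c (y + t *: v) ->
  speed g (fun t => param c (y + t *: v)) t =
  Num.sqrt ((v *m g c (y + t *: v) *m v^T) 0 0).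
Proof.
move=> ac ct; rewrite /speed; set c' := chart_at S _.
have ac' : atlas S c' by exact: chart_at_atlas.
have ot : overlap c c' (y + t *: v) by split => //; exact: chart_at_dom.
have D := is_derive_transition_line ac ac' ot.
rewrite derive1E derive_val (gmat_change g ac ac' ot) trmx_mul.
by rewrite -/(transition c c' _) !mulmxA.
Qed.

Lemma path_length_line c y v (K : R) : 0 <= K -> atlas S c ->
  (forall t, 0 <= t <= 1 -> cod c (y + t *: v)) ->
  (forall t, 0 <= t <= 1 -> forall i j, `|g c (y + t *: v) i j| <= K) ->
  exists2 l, path_length g (param c y) (param c (y + v)) l &
    (l <= (Num.sqrt ((n * n)%:R * K) * `|v|)%:E)%E.
Proof.
move=> K0 ac seg gK.
pose gamma (t : R) := param c (y + t *: v).
exists (\int[@lebesgue_measure R]_(t in `[0%R, 1%R]) (speed g gamma t)%:E)%E.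
  have := path_arc g (C1_arc_line ac seg).
  by rewrite scale0r addr0 scale1r.
apply: le_trans (ge0_le_integral_pointwise
  (f2 := cst (Num.sqrt ((n * n)%:R * K) * `|v|)%:E) _ _ _) _.
- by move=> t _; rewrite lee_fin sqrtr_ge0.
- move=> t /=; rewrite in_itv /= => t01; rewrite lee_fin speed_line //; last exact: seg.
  rewrite -[`|v|]ger0_norm // -sqrtr_sqr -sqrtrM; last by rewrite mulr_ge0.
  by apply: ler_wsqrtr; apply: quadratic_form_bound => i j; exact: gK.
rewrite integral_cst //= lebesgue_measure_itv /= lte_fin ltr01.
by rewrite sube0 mule1.
Qed.

(** In a chart around p the coefficients of the metric are bounded by some K on a
    ball, so that the length of the coordinate segment from q to p is at most a constant
    C times its coordinate length. *)
Lemma near_riemannian_dist (p : M) (e : R) : 0 < e ->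
  \forall q \near p, (riemannian_dist g q p < e%:E)%E.
Proof.
move=> e0; pose c := chart_at S p; pose x0 := coord c p.
have ac : atlas S c by exact: chart_at_atlas.
have dp : dom c p by exact: chart_at_dom.
have cx0 : cod c x0 by exact: coord_cod.
pose K := \sum_i \sum_j `|g c x0 i j| + 1.
have K0 : 0 <= K.
  by rewrite addr_ge0 //; apply: sumr_ge0 => i _; apply: sumr_ge0.
have nK : \forall y \near x0, forall ij : 'I_n * 'I_n, `|g c y ij.1 ij.2| <= K.
  apply: (@filter_forall _ _ (fun ij y => `|g c y ij.1 ij.2| <= K) _ (nbhs_filter x0)).
  move=> [i j] /=.
  have : {for x0, continuous (fun x => g c x i j)}.
    apply: differentiable_continuous.
    exact: (gmat_smooth g ac i j [::]).
  move=> /cvgrPdist_lt/(_ _ ltr01); apply: filterS => y yP.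
  have -> : g c y i j = g c x0 i j - (g c x0 i j - g c y i j) by rewrite subKr.
  apply: le_trans (ler_normB _ _) _; apply: lerD; last exact: ltW.
  rewrite (bigD1 i) //= (bigD1 j) //= -addrA lerDl addr_ge0 //.
    by apply: sumr_ge0.
  by apply: sumr_ge0 => a _; apply: sumr_ge0.
have nC : \forall y \near x0, cod c y.
  by apply: open_nbhs_nbhs; split => //; exact: cod_open.
have [r /= r0 rP] : exists2 r : R, 0 < r & forall y, ball x0 r y ->
    cod c y /\ forall i j, `|g c y i j| <= K.
  have /nbhs_ballP[r1 /= r10 P1] := nK; have /nbhs_ballP[r2 /= r20 P2] := nC.
  exists (Num.min r1 r2); first by rewrite lt_min r10.
  move=> y yr; split.
    by apply: P2; apply: le_ball yr; rewrite ge_min lexx orbT.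
  move=> i j; apply: (P1 y _ (i, j)).
  by apply: le_ball yr; rewrite ge_min lexx.
pose C := Num.sqrt ((n * n)%:R * K).
have C0 : 0 <= C by exact: sqrtr_ge0.
(* C + 1 rather than C, which may be 0 *)
pose d := Num.min r (e / (C + 1)).
have d0 : 0 < d by rewrite lt_min r0 divr_gt0 // ltr_wpDl.
have nq : \forall q \near p, dom c q /\ ball x0 d (coord c q).
  apply: filterI; first by apply: open_nbhs_nbhs; split => //; exact: dom_open.
  have nb : nbhs (coord c p) (ball x0 d) by exact: nbhsx_ballx.
  exact: (Defs.coord_continuous dp nb).
apply: filterS nq => q [dq bq].
pose y := coord c q; pose v := x0 - y.
have vd : `|v| < d by move: bq; rewrite -ball_normE.
have seg t : 0 <= t <= 1 -> ball x0 r (y + t *: v).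
  move=> /andP[t0 t1]; rewrite -ball_normE /ball_ /=.
  have -> : x0 - (y + t *: v) = (1 - t) *: v.
    by rewrite opprD addrA -/v scalerBl scale1r.
  rewrite normrZ ger0_norm ?subr_ge0 //.
  apply: (@le_lt_trans _ _ `|v|); first by rewrite ler_piMl // lerBlDr lerDl.
  by apply: lt_le_trans vd _; rewrite ge_min lexx.
have [l pl lC] := path_length_line K0 ac (fun t t01 => (rP _ (seg t t01)).1)
  (fun t t01 => (rP _ (seg t t01)).2).
move: pl; rewrite [y + v]addrC subrK !coordK // => pl.
apply: le_lt_trans (le_trans _ lC) _; first exact: ereal_inf_lbound.
rewrite lte_fin -/C; apply: (@le_lt_trans _ _ ((C + 1) * `|v|)).
  by rewrite ler_wpM2r // lerDl.
rewrite mulrC -ltr_pdivlMr; last by rewrite ltr_wpDl.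
by apply: lt_le_trans vd _; rewrite ge_min lexx orbT.
Qed.

(** A Cauchy sequence has a cluster point p by compactness; terms close to p in the
    topology are close in distance by [near_riemannian_dist], and they carry
    along the whole tail of the sequence. *)
Lemma closed_manifold_complete : closed_manifold S -> complete_metric g.
Proof.
move=> cM u uC.
have [p [_ clp]] : [set: M] `&` cluster (u @ \oo) !=set0.
  by apply: cM; exact: filterT.
exists p => e e0; have e20 : 0 < e / 2 by rewrite divr_gt0.
have [N NP] := uC _ e20; exists N => m Nm.
have uN : (u @ \oo) [set q | (riemannian_dist g (u m) q < (e / 2)%:E)%E].
  by exists N => // k /= Nk; exact: NP.
have [q [/= mq qp]] := clp _ _ uN (near_riemannian_dist p e20).
have [l1 pl1 l1e] := ereal_inf_lt mq; have [l2 pl2 l2e] := ereal_inf_lt qp.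
apply: (@le_lt_trans _ _ (l1 + l2)%E).
  by apply: ereal_inf_lbound; exact: path_cat pl1 pl2.
by rewrite [e]splitr EFinD; exact: lteD.
Qed.

End Paths.

(** * The theorem *)

Section ChartMetric.
Context (R : realType) (n : nat) (M : ptopologicalType)
  (S : smooth_structure R n M) (g : riemannian_metric S) (f : M -> R).
Context (hCPE : CPE_metric g f) (c : chart R n M) (ac : atlas S c).

Lemma chart_metric : metric_on (cod c) (g c).
Proof.
split.
- exact: cod_open.
- exact: gmat_smooth.
- exact: gmat_sym.
- by move=> x cx; apply: posdef_unit => v; exact: gmat_posdef.
Qed.

Lemma chart_posdef x : cod c x -> posdef (g c x).
Proof. by move=> cx v; exact: gmat_posdef. Qed.

Lemma chart_einstein_kernel :
  (forall x, cod c x -> forall i j, traceless_ricci (g c) i j x = 0) <->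
  (forall x, cod c x -> forall i j,
     Lambda_star_coord (g c) (f \o param c) i j x = 0).
Proof.
have [n3 _ _ [k scalk] _ sf cpe] := hCPE.
have gU := chart_metric.
have su := sf c ac.
have sk x (cx : cod c x) := scalk c x ac cx.
have eq x (cx : cod c x) := cpe c x ac cx.
split; first exact: (einstein_in_kernel gU n3 su sk eq).
exact: (kernel_einstein gU chart_posdef n3 su sk eq).
Qed.

End ChartMetric.

Theorem theorem1p4 (R : realType) (n : nat) (hn : (3 <= n)%N)
    (M : ptopologicalType) (S : smooth_structure R n M)
    (g : riemannian_metric S) (f : M -> R)
    (hCPE : CPE_metric g f)
    (hf : exists p q : M, f p <> f q) :
  (einstein g <-> in_ker_Lambda_star g f) /\
  (einstein g <-> sigma2_singular g f).
Proof.
have einstein_ker : einstein g <-> in_ker_Lambda_star g f.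
  split=> [ein|[_ ker]].
    split=> [|c x ac cx]; first exact: CPE_smooth hCPE.
    by apply: (chart_einstein_kernel hCPE ac).1 cx => y cy; exact: ein.
  move=> c x ac cx.
  by apply: (chart_einstein_kernel hCPE ac).2 cx => y cy; exact: ker.
split=> //; rewrite einstein_ker; split=> [ker|[]//].
split=> //; first exact: closed_manifold_complete (CPE_closed hCPE).
have [p [q fpq]] := hf.
have [fp0|fp0] := eqVneq (f p) 0; last by exists p.
by exists q; rewrite -fp0; apply/eqP => fqp; exact: fpq.
Qed.
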